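(* Let $r\ge 2$ and $d,n\ge 1$ be integers. Let $\Sigma\in\mathbb{R}^{d\times d}$ be a positive-definite matrix with largest eigenvalue $\sigma_1^2$, and let $a_1,\dots,a_n$ be i.i.d. $\Sigma$-subgaussian random vectors in $\mathbb{R}^d$. Let $f_1,\dots,f_r:\mathbb{R}\to\mathbb{R}$ be $1$-Lipschitz functions with $f_k(0)=0$ for all $k\in[r]$. For each $k\in[r]$ let $B_k>0$ be such that almost surely $|f_k(a_i^\top x)|\le B_k$ for all $x\in\mathcal{B}$ and all $i\in[n]$, and set $B=B_1\cdots B_r$. Define $$Y:=\sup_{x_1,\dots,x_r\in\mathcal{B}}\frac1n\sum_{i=1}^n\prod_{k=1}^r f_k(a_i^\top x_k).$$ Then there is a constant $C_r>0$ depending only on $r$ such that for every $\lambda>0$, $$\mathbb{P}\left(Y\ge \sigma_1^rC_r\left(1+\frac{d_{\rm eff}(r)\ln(d)+\lambda}{n}\,(\sigma_1^{-r}B)^{1-2/r}\right)\right)\le e^{-\lambda}.$$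
   Context: $\mathcal{B}$ denotes the closed Euclidean unit ball of $\mathbb{R}^d$ and $[m]=\{1,\dots,m\}$. A random vector $a$ in $\mathbb{R}^d$ is $\Sigma$-subgaussian (for a positive-definite $\Sigma\in\mathbb{R}^{d\times d}$) if for all $t>0$ and all $x\in\mathcal{B}$, $\mathbb{P}(|a^\top x|>t)\le 2\exp\!\left(-\frac{t^2}{2\,x^\top\Sigma x}\right)$. For a symmetric positive semi-definite $\Sigma$ with ordered eigenvalues $\sigma_1^2\ge\sigma_2^2\ge\dots\ge\sigma_d^2\ge0$ ($\sigma_i\ge 0$) and an integer $r\ge1$, the effective dimension is $d_{\rm eff}(r):=\sum_{i=1}^d(\sigma_i/\sigma_1)^{2/r}=\operatorname{Tr}(\Sigma^{1/r})/\|\Sigma^{1/r}\|_{\rm op}$. *)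

(* Defs.v *)
From HB Require Import structures.
From mathcomp Require Import all_boot all_order all_algebra.
From mathcomp Require Import all_classical all_reals all_analysis.
Set Implicit Arguments. Unset Strict Implicit. Unset Printing Implicit Defensive.
Import Order.TTheory GRing.Theory Num.Theory.
Local Open Scope classical_set_scope.
Local Open Scope ring_scope.

Section Defs.
Variable R : realType.

Definition dotv (d : nat) (a x : 'cV[R]_d) : R := \sum_(j < d) a j 0 * x j 0.

Definition unit_ball (d : nat) : set 'cV[R]_d :=
  [set x | \sum_(j < d) x j 0 ^+ 2 <= 1].

Definition qform (d : nat) (S : 'M[R]_d) (x : 'cV[R]_d) : R :=
  (x^T *m S *m x) 0 0.

Definition posdef (d : nat) (S : 'M[R]_d) : Prop :=
  S^T = S /\ forall x : 'cV[R]_d, x != 0 -> 0 < qform S x.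

(* Borel sigma-algebra of R^d: generated by coordinate cylinders *)
Definition cV_measurable (d : nat) : set (set 'cV[R]_d) :=
  <<s [set C | exists (j : 'I_d) (A : set R), measurable A /\ C = [set x : 'cV[R]_d | A (x j 0)]] >>.

Definition vec_sigma (T : Type) (d : nat) (a : T -> 'cV[R]_d) : set (set T) :=
  [set a @^-1` A | A in @cV_measurable d].

Definition random_vector (d0 : measure_display) (T : measurableType d0)
  (d : nat) (a : T -> 'cV[R]_d) : Prop :=
  forall A, cV_measurable A -> measurable (a @^-1` A).

Definition mutually_independent (d0 : measure_display) (T : measurableType d0)
  (P : probability T R) (n d : nat) (a : 'I_n -> T -> 'cV[R]_d) : Prop :=
  forall (J : {set 'I_n}) (E : 'I_n -> set T),
    (forall i, i \in J -> vec_sigma (a i) (E i)) ->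
    P (\bigcap_(i in [set i | i \in J]) E i) = (\prod_(i in J) P (E i))%E.

Definition identically_distributed (d0 : measure_display) (T : measurableType d0)
  (P : probability T R) (n d : nat) (a : 'I_n -> T -> 'cV[R]_d) : Prop :=
  forall (i j : 'I_n) (A : set 'cV[R]_d), cV_measurable A ->
    P (a i @^-1` A) = P (a j @^-1` A).

Definition iid (d0 : measure_display) (T : measurableType d0)
  (P : probability T R) (n d : nat) (a : 'I_n -> T -> 'cV[R]_d) : Prop :=
  (forall i, random_vector (a i)) /\ mutually_independent P a /\
  identically_distributed P a.

Definition subgaussian (d0 : measure_display) (T : measurableType d0)
  (P : probability T R) (d : nat) (S : 'M[R]_d) (a : T -> 'cV[R]_d) : Prop :=
  forall (t : R) (x : 'cV[R]_d), 0 < t -> unit_ball x ->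
    (P [set w | (t < `|dotv (a w) x|)%R] <=
      ((2 * expR (- (t ^+ 2 / (2 * qform S x))))%R)%:E)%E.

Definition lipschitz1 (f : R -> R) : Prop :=
  forall x y, `|f x - f y| <= `|x - y|.

(* largest singular value sigma_1 from the family sigma_i (sigma_i^2 the eigenvalues) *)
Definition sigma_max (d : nat) (sigma : 'I_d -> R) : R :=
  \big[Order.max/0]_(i < d) sigma i.

Definition d_eff (d : nat) (sigma : 'I_d -> R) (r : nat) : R :=
  \sum_(i < d) powR (sigma i / sigma_max sigma) (2 / r%:R).

Definition Ysup (T : Type) (n d r : nat) (a : 'I_n -> T -> 'cV[R]_d)
  (f : 'I_r -> R -> R) (w : T) : R :=
  sup [set y | exists xs : 'I_r -> 'cV[R]_d, (forall k, unit_ball (xs k)) /\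
        y = n%:R^-1 * \sum_(i < n) \prod_(k < r) f k (dotv (a i w) (xs k))].

End Defs.

(* Main.v *)
Require Import Defs.
From HB Require Import structures.
From mathcomp Require Import all_boot all_order all_algebra.
From mathcomp Require Import all_classical all_reals all_analysis.
From mathcomp Require Import measurable_realfun.
From mathcomp Require Import zify ring lra.
Import Order.TTheory GRing.Theory Num.Theory.
Import numFieldNormedType.Exports HBSimple HBNNSimple.
Local Open Scope classical_set_scope.
Local Open Scope ring_scope.

(* Since [prod_k u_k <= max_k u_k^r], the product is dominated by a sum over k of
   [min(|a.x_k|^r, B)], so it suffices to control, for a single x in the ball,
   [sum_i min(|a_i.x|^r, B)].  The truncated power is dominated by a convex function psi
   (the power, extended by its tangent) which is at most [|v|^r] and at most a multiple of
   [B^(1-2/r) v^2].  The first bound controls its mean, the second its exponential moments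
   at rate of order [B^(2/r-1)], so Chernoff's inequality applies at every point z with
   [z^T Sigma z <= 4 sigma_1^2], whatever its Euclidean norm.

   By convexity it remains to find few such points whose convex hull contains the ball.
   In an orthonormal eigenbasis put [s_j = sigma_j / sigma_1] and [K = sum_j s_j], which is at most
   d_eff(r) because r >= 2.  On the grid of mesh [h_j = (K s_j)^(-1/2)] a unit vector has at most K
   steps in total, by Cauchy-Schwarz, and rounding moves it by at most
   [sum_j s_j^2 h_j^2 = 1] in the (squared) norm of Sigma / sigma_1^2.  The box constraints together
   with one bound on the total number of steps form an integral polytope, so the ball
   lies in the hull of the grid points with at most [K + 1] steps; there are
   [(2d + 1)^(K + 1) <= exp(6 K ln d)] of them when [d >= 2]. *)

(** * Real spectral theorem for a matrix with split characteristic polynomial *)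

Lemma sqnorm_rV_eq0 {R : realFieldType} (d : nat) (v : 'rV[R]_d) :
  ((v *m v^T) 0 0 == 0) = (v == 0).
Proof.
apply/eqP/eqP => [|->]; last by rewrite mul0mx mxE.
rewrite mxE => /eqP; rewrite psumr_eq0; last by move=> i _; rewrite mxE -expr2 sqr_ge0.
move=> /allP v0; apply/rowP => i; rewrite mxE.
by have := v0 i (mem_index_enum i); rewrite /= mxE -expr2 sqrf_eq0 => /eqP.
Qed.

(** When [u != v], the reflection in the hyperplane orthogonal to [u - v] swaps the two vectors
    because they have equal length. *)
Lemma householder {R : realFieldType} (d : nat) (u v : 'rV[R]_d) :
  u *m u^T = 1%:M -> v *m v^T = 1%:M ->
  exists H : 'M[R]_d, [/\ H^T = H, H *m H = 1%:M & u *m H = v].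
Proof.
move=> uu vv; have [->|uv] := eqVneq u v.
  by exists 1%:M; rewrite tr_scalar_mx !mulmx1.
pose w := u - v; pose c := (w *m w^T) 0 0.
have c0 : c != 0 by rewrite sqnorm_rV_eq0 subr_eq0.
have wwE : w *m w^T = c%:M by rewrite [LHS]mx11_scalar.
have uvE : u *m v^T = v *m u^T.
  by rewrite [RHS]mx11_scalar -tr_scalar_mx -mx11_scalar trmx_mul trmxK.
(* For unit vectors [|u - v|^2 = 2 - 2 u.v = 2 u.(u - v)], so the reflection subtracts exactly [w]
   from [u]. *)
have cE : c = 2 * (u *m w^T) 0 0.
  have wT : w^T = u^T - v^T by rewrite /w linearB.
  rewrite /c wT /w mulmxBl !mulmxBr vv uvE uu !mxE /=; ring.
pose P := w^T *m w.
have PP : P *m P = c *: P.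
  by rewrite /P mulmxA -[w^T *m w *m w^T]mulmxA wwE mul_mx_scalar -scalemxAl.
exists (1%:M - (2 / c) *: P); split.
- by rewrite linearB /= linearZ /= trmx_mul trmxK tr_scalar_mx.
- rewrite mulmxBl mul1mx mulmxBr mulmx1 -scalemxAl -scalemxAr PP !scalerA.
  have -> : 2 / c * (2 / c) * c = 2 / c + 2 / c by field.
  by rewrite scalerDl opprB -addrA (addrA (- _)) addKr addrA addrAC addrNK ?addrK.
- rewrite mulmxBr mulmx1 -scalemxAr mulmxA [u *m w^T]mx11_scalar mul_scalar_mx scalerA.
  have -> : 2 / c * (u *m w^T) 0 0 = 1.
    by rewrite mulrAC -cE divff.
  by rewrite scale1r /w opprB addrC subrK.
Qed.

(** Deflation: a Householder reflection takes a unit eigenvector to the first basis vector, and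
    symmetry splits off a smaller symmetric block. Prescribing the factorization fixes the order and
    multiplicity of the eigenvalues [l]. *)
Lemma symmetric_orthodiag {R : rcfType} (d : nat) (S : 'M[R]_d) (l : 'I_d -> R) :
  S^T = S -> char_poly S = \prod_(i < d) ('X - (l i)%:P) ->
  exists U : 'M[R]_d, U *m U^T = 1%:M /\ S = U^T *m diag_mx (\row_i l i) *m U.
Proof.
elim: d S l => [|d IHd] S l symS charS.
  by exists 1%:M; rewrite trmx1 mulmx1; split=> //; apply/matrixP => -[].
have /eigenvalueP[v vS v0] : eigenvalue S (l ord0).
  by rewrite eigenvalue_root_char charS big_ord_recl rootM root_XsubC eqxx.
pose c := (v *m v^T) 0 0.
have c0 : 0 < c.
  rewrite lt_neqAle eq_sym sqnorm_rV_eq0 v0 /c mxE.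
  by apply: sumr_ge0 => i _; rewrite mxE -expr2 sqr_ge0.
pose u := (Num.sqrt c)^-1 *: v.
have uu : u *m u^T = 1%:M.
  rewrite /u linearZ /= -scalemxAr -scalemxAl scalerA -invfM -expr2 sqr_sqrtr ?ltW//.
  by rewrite [v *m _]mx11_scalar -/c scale_scalar_mx mulVf ?gt_eqF.
have uS : u *m S = l ord0 *: u by rewrite -scalemxAl vS !scalerA mulrC.
pose e : 'rV[R]_(1 + d) := row_mx 1%:M 0.
have ee : e *m e^T = 1%:M by rewrite tr_row_mx mul_row_col trmx1 mulmx1 trmx0 mulmx0 addr0.
have [H [HT HH eH]] := householder _ e u ee uu.
pose S' : 'M[R]_(1 + d) := H *m S *m H.
have S'T : S'^T = S' by rewrite !trmx_mul HT symS mulmxA.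
have eS' : e *m S' = l ord0 *: e.
  by rewrite !mulmxA eH uS -scalemxAl -eH -mulmxA HH mulmx1.
have S'E : S' = block_mx (l ord0)%:M 0 0 (drsubmx S').
  have := eS'; rewrite -{1}[S']submxK mul_row_block !mul1mx !mul0mx !addr0.
  rewrite scale_row_mx scaler0 scale_scalar_mx mulr1 => /eq_row_mx[ul ur].
  rewrite -{1}[S']submxK ul ur; congr block_mx.
  by rewrite -[dlsubmx S']trmxK trmx_dlsub S'T ur trmx0.
have charS' : char_poly S' = char_poly S.
  rewrite /char_poly /char_poly_mx.
  have XE : 'X%:M = map_mx polyC H *m 'X%:M *m map_mx polyC H :> 'M[{poly R}]_d.+1.
    by rewrite mul_mx_scalar -scalemxAl -map_mxM HH map_mx1 scalemx1.
  rewrite [X in X - _]XE /S' !map_mxM -mulmxBl -mulmxBr !det_mulmx mulrAC -det_mulmx.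
  by rewrite -map_mxM HH map_mx1 det1 mul1r.
have [||V [VV drE]] := IHd (drsubmx S') (fun i => l (lift ord0 i)).
- by rewrite trmx_drsub S'T.
(* Conjugation by [H] preserves the characteristic polynomial, so the factor of [l ord0] cancels. *)
- apply: (@mulfI _ ('X - (l ord0)%:P)); first by rewrite polyXsubC_eq0.
  transitivity (char_poly S'); last by rewrite charS' charS big_ord_recl.
  rewrite [in RHS]S'E /char_poly char_block_diag_mx.
  rewrite det_ublock; congr (_ * _).
  by rewrite [char_poly_mx _]mx11_scalar det_scalar1 !mxE eqxx mulr1n.
pose W : 'M[R]_(1 + d) := block_mx 1%:M 0 0 V.
have WT : W^T = block_mx 1%:M 0 0 V^T by rewrite tr_block_mx !trmx0 trmx1.
have WW : W *m W^T = 1%:M.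
  rewrite WT mulmx_block !mulmx0 !mul0mx !mulmx1 !addr0 add0r VV.
  by rewrite -scalar_mx_block.
have lE : \row_i l i = row_mx (l ord0)%:M (\row_i l (lift ord0 i)) :> 'rV_(1 + d).
  apply/rowP => i; rewrite !mxE; case: splitP => j ij; rewrite !mxE.
    by rewrite !ord1 eqxx; congr l; apply: val_inj; rewrite /= ij ord1.
  by congr l; apply: val_inj.
have S'W : S' = W^T *m diag_mx (\row_i l i : 'rV_(1 + d)) *m W.
  rewrite lE diag_mx_row S'E drE WT.
  rewrite !mulmx_block !mulmx0 !mul0mx !mulmx1 !addr0 !add0r mul1mx.
  congr (block_mx _ _ _ _).
    by apply/matrixP => i j; rewrite !ord1 !mxE.
  by rewrite mul0mx.
exists (W *m H); split.
  by rewrite trmx_mul HT mulmxA -[_ *m H *m H]mulmxA HH mulmx1.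
have -> : S = H *m S' *m H by rewrite !mulmxA HH mul1mx -mulmxA HH mulmx1.
by rewrite trmx_mul HT S'W !mulmxA.
Qed.

(** * Rounding in an integral polytope *)

Fixpoint fold_sums {V : zmodType} (st : seq V) (m : nat) : seq V :=
  if m is m'.+1 then [seq x + y | x <- st, y <- fold_sums st m'] else [:: 0].

Lemma size_fold_sums {V : zmodType} (st : seq V) (m : nat) :
  size (fold_sums st m) = (size st ^ m)%N.
Proof. by elim: m => //= m IHm; rewrite size_allpairs IHm expnS. Qed.

(** Places left over among the [m] are filled with the zero step. *)
Lemma mem_fold_sums {V : zmodType} (I : finType) (st : seq V) (w : I -> V)
    (m : nat) (q : I -> nat) :
  0 \in st -> (forall i, w i \in st) -> (\sum_i q i <= m)%N ->
  \sum_i w i *+ q i \in fold_sums st m.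
Proof.
move=> st0 stw; elim: m q => [|m IHm] q qm.
  move: qm; rewrite leqn0 sum_nat_eq0 => /forallP q0.
  by rewrite big1 ?inE// => i _; rewrite (eqP (implyP (q0 i) isT)) mulr0n.
have [qm'|mq] := leqP (\sum_i q i)%N m.
  by rewrite -[X in X \in _]add0r; apply: allpairs_f => //; apply: IHm.
have [i qi] : exists i, (0 < q i)%N.
  apply/existsP; rewrite -[X in is_true X]negbK negb_exists; apply/negP => /forallP q0.
  by move: mq; rewrite big1// => i _; apply/eqP; rewrite -leqn0 leqNgt.
pose q' j := (if j == i then (q i).-1 else q j).
have q'E : \sum_j w j *+ q j = w i + \sum_j w j *+ q' j.
  rewrite (bigD1 i)//= [in RHS](bigD1 i)//= addrA /q' eqxx -mulrS prednK//.
  by congr (_ + _); apply: eq_bigr => j /negPf ->.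
rewrite q'E; apply: allpairs_f => //; apply: IHm.
rewrite -ltnS (leq_trans _ qm)// (bigD1 i)//= [X in (_ < X)%N](bigD1 i)//=.
rewrite /q' eqxx -addSn prednK//.
by rewrite leq_add2l leq_sum// => j /negPf ->.
Qed.

Definition quasiconvex {R : realType} {V : lmodType R} (F : V -> R) :=
  forall (t : R) (x y : V), 0 <= t <= 1 ->
    F (t *: x + (1 - t) *: y) <= Num.max (F x) (F y).

(** If every other entry were 0 or 1, then [p i] would be an integer strictly between 0 and 1. *)
Lemma sum_natr_frac {R : realType} (J : finType) (p : J -> R) (k : nat) (i : J) :
  (forall j, 0 <= p j <= 1) -> \sum_j p j = k%:R -> 0 < p i < 1 ->
  exists2 j, j != i & 0 < p j < 1.
Proof.
move=> p01 pk pi; apply: contrapT => noj.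
have pN j : j != i -> p j = (p j == 1)%:R.
  move=> ji; have /andP[p0 p1] := p01 j.
  case: eqP => [//|/eqP pj1]; apply: contrapT => /eqP pj0; apply: noj; exists j => //.
  by rewrite !lt_neqAle p0 p1 pj1 eq_sym pj0.
move: pk; rewrite (bigD1 i)//= (eq_bigr (fun j => (p j == 1)%:R)); last by move=> j /pN.
rewrite -natr_sum => pE.
have : p i = (k%:Z - (\sum_(j | j != i) (p j == 1%R))%N%:Z)%:~R.
  by rewrite rmorphB /= -!pmulrn -pE addrK.
move=> piE; move: pi; rewrite piE -[0]/(0%:~R) -[1]/(1%:~R) !ltr_int; lia.
Qed.

Definition shift_coord {R : realType} {J : finType} (p : {ffun J -> R}) (i j : J) (a : R) :
    {ffun J -> R} :=
  [ffun l => if l == i then p i + a else if l == j then p j - a else p l].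

Lemma sum_shift_coord {R : realType} (J : finType) (p : {ffun J -> R}) (i j : J) (a : R) :
  j != i -> \sum_l shift_coord p i j a l = \sum_l p l.
Proof.
move=> ji; rewrite (bigD1 i)//= (bigD1 j)//= [RHS](bigD1 i)//= [in RHS](bigD1 j)//=.
rewrite (eq_bigr p) => [|l /andP[/negPf li /negPf lj]]; last by rewrite ffunE li lj.
by rewrite !ffunE !eqxx (negPf ji); lra.
Qed.

(** The transfer from [j] to [i] is pushed until [p i] reaches 1 or [p j] reaches 0; then one of
    them is integral and no new coordinate has become fractional. *)
Lemma shift_coord_step {R : realType} (J : finType) (p : {ffun J -> R}) (i j : J) :
  (forall l, 0 <= p l <= 1) -> j != i -> 0 < p i < 1 -> 0 < p j < 1 ->
  exists a, [/\ 0 < a, forall l, 0 <= shift_coord p i j a l <= 1 &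
    [set l | 0 < shift_coord p i j a l < 1] \proper [set l | 0 < p l < 1]]%SET.
Proof.
move=> p01 ji /andP[pi0 pi1] /andP[pj0 pj1].
exists (Num.min (1 - p i) (p j)); set a := Num.min _ _.
have ai : a <= 1 - p i by rewrite ge_min lexx.
have aj : a <= p j by rewrite ge_min lexx orbT.
have a0 : 0 < a by rewrite lt_min subr_gt0 pi1.
split=> // [l|].
  rewrite ffunE; case: eqP => _; first by apply/andP; split; lra.
  by case: eqP => _ //; apply/andP; split; lra.
apply/properP; split.
  apply/fintype.subsetP => l; rewrite !inE ffunE.
  case: eqP => [->|_]; first by rewrite pi0 pi1.
  by case: eqP => [->|//]; rewrite pj0 pj1.
have [aE|aE] : a = 1 - p i \/ a = p j by rewrite /a; case: leP; [left|right].
- exists i; first by rewrite inE pi0.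
  by rewrite inE ffunE eqxx aE addrC subrK ltxx andbF.
- exists j; first by rewrite inE pj0.
  by rewrite inE ffunE eqxx (negPf ji) aE subrr ltxx.
Qed.

(* Two fractional coordinates can be traded against each other in both directions, and
   H does not decrease in one of them. *)
Lemma quasiconvex_round01 {R : realType} (J : finType) (H : {ffun J -> R} -> R)
    (p : {ffun J -> R}) (k : nat) :
  quasiconvex H -> (forall j, 0 <= p j <= 1) -> \sum_j p j = k%:R ->
  exists q : J -> bool, (\sum_j q j)%N = k /\ H p <= H [ffun j => (q j)%:R].
Proof.
(* Induction on the number of fractional coordinates, which every trade lowers. *)
move=> qcH; have [n] := ubnP #|[set j | 0 < p j < 1]%SET|.
elim: n p => // n IHn p pn p01 pk.
have [p0|[i]] := set_0Vmem [set j | 0 < p j < 1]%SET.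
  have pE j : p j = (p j == 1)%:R.
    have /andP[p0j p1j] := p01 j; have : j \notin [set j | 0 < p j < 1]%SET by rewrite p0 inE.
    case: eqP => [//|/eqP pj1]; rewrite inE !lt_neqAle p0j p1j pj1 !andbT.
    by rewrite eq_sym negbK => /eqP.
  exists (fun j => p j == 1); split.
    by apply/eqP; rewrite -(eqr_nat R) -pk natr_sum; apply/eqP/eq_bigr => j _.
  by rewrite le_eqVlt; apply/orP; left; apply/eqP; congr H; apply/ffunP => j; rewrite ffunE.
rewrite inE => pi; have [j ji pj] := sum_natr_frac _ _ _ _ p01 pk pi.
have ij : i != j by rewrite eq_sym.
have [a [a0 a01 an]] := shift_coord_step _ _ _ _ p01 ji pi pj.
have [b [b0 b01 bn]] := shift_coord_step _ _ _ _ p01 ij pj pi.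
(* The weights are inversely proportional to the transferred masses [a] and [b], so that the two
   opposite transfers cancel. *)
have pE : p = (b / (a + b)) *: shift_coord p i j a + (1 - b / (a + b)) *: shift_coord p j i b.
  apply/ffunP => l; rewrite !ffunE.
  have ab : a + b != 0 by rewrite gt_eqF ?addr_gt0.
  have scaleE (x y : R) : x *: (y : R^o) = x * y by [].
  rewrite !scaleE; case: (eqVneq l i) => [->|li]; first by rewrite (negPf ij); field.
  by case: (eqVneq l j) => [->|lj]; rewrite ?(negPf ji); field.
have t01 : 0 <= b / (a + b) <= 1.
  apply/andP; split; first by rewrite divr_ge0// ?addr_ge0// ltW.
  by rewrite ler_pdivrMr ?addr_gt0// mul1r lerDr ltW.
have := qcH (b / (a + b)) (shift_coord p i j a) (shift_coord p j i b) t01; rewrite -pE.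
rewrite le_max => /orP[] Hp.
- have [||q [qk Hq]] := IHn _ _ a01; first by rewrite (leq_trans (proper_card an)).
    by rewrite sum_shift_coord.
  by exists q; split=> //; exact: le_trans Hq.
- have [||q [qk Hq]] := IHn _ _ b01; first by rewrite (leq_trans (proper_card bn)).
    by rewrite sum_shift_coord.
  by exists q; split=> //; exact: le_trans Hq.
Qed.

Lemma sum_option {V : nmodType} (J : finType) (f : option J -> V) :
  \sum_o f o = f None + \sum_j f (Some j).
Proof.
rewrite (bigD1 None)//=; congr (_ + _).
rewrite (reindex_omap Some id) => [|[]]//.
by apply: eq_bigl => j; rewrite /= eqxx.
Qed.

(** Integer parts are kept; the fractional parts, whose sum is an integer once a slack coordinate is
    added, are rounded to 0 or 1. *)
Lemma quasiconvex_round_nat {R : realType} (J : finType) (H : {ffun J -> R} -> R)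
    (y : {ffun J -> R}) (m : nat) :
  quasiconvex H -> (forall j, 0 <= y j) -> \sum_j y j <= m%:R ->
  exists q : J -> nat, [/\ (\sum_j q j <= m)%N, forall j, (q j)%:R <= y j + 1 &
    H y <= H [ffun j => (q j)%:R]].
Proof.
move=> qcH y0 ym.
(* The slack at [None] turns the bound [m] on the total into an equality, as rounding at a fixed sum
   requires. *)
pose y' (o : option J) := oapp y (m%:R - \sum_j y j) o.
have y'0 o : 0 <= y' o by case: o => [j|] //=; rewrite subr_ge0.
have sumy' : \sum_o y' o = m%:R by rewrite sum_option /= subrK.
pose p : {ffun option J -> R} := [ffun o => y' o - (Num.truncn (y' o))%:R].
pose H' (p : {ffun option J -> R}) := H [ffun j => (Num.truncn (y j))%:R + p (Some j)].
have qcH' : quasiconvex H'.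
  move=> t u v t01; have := qcH t [ffun j => (Num.truncn (y j))%:R + u (Some j)]
    [ffun j => (Num.truncn (y j))%:R + v (Some j)] t01.
  congr (H _ <= _); apply/ffunP => j; rewrite !ffunE.
  have scaleE (a b : R) : a *: (b : R^o) = a * b by [].
  by rewrite !scaleE; ring.
have p01 o : 0 <= p o <= 1.
  rewrite ffunE; have /andP[t1 t2] := truncn_itv (y'0 o).
  by rewrite subr_ge0 t1 lerBlDl ltW// natr1.
have tm : (\sum_o Num.truncn (y' o) <= m)%N.
  rewrite -(ler_nat R) natr_sum -sumy'; apply: ler_sum => o _.
  by have /andP[] := truncn_itv (y'0 o).
have pk : \sum_o p o = (m - \sum_o Num.truncn (y' o))%N%:R.
  rewrite natrB// natr_sum -sumy' -sumrB.
  by apply: eq_bigr => o _; rewrite ffunE.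
have [b [bk Hb]] := quasiconvex_round01 _ _ _ _ qcH' p01 pk.
exists (fun j => (Num.truncn (y j) + b (Some j))%N); split.
- have : (\sum_o (Num.truncn (y' o) + b o) <= m)%N.
    by rewrite big_split/= bk addnC subnK.
  by apply: leq_trans; rewrite sum_option leq_addl.
- move=> j; rewrite natrD lerD//; first by have /andP[] := truncn_itv (y0 j).
  by rewrite lern1 leq_b1.
- apply: le_trans (le_trans Hb _).
    by rewrite le_eqVlt; apply/orP; left; apply/eqP; congr H; apply/ffunP => j;
       rewrite !ffunE addrC subrK.
  by rewrite le_eqVlt; apply/orP; left; apply/eqP; congr H; apply/ffunP => j;
     rewrite !ffunE natrD.
Qed.

(** * Counting and rounding on grids *)

(** [2 d + 1 <= d^3] once [d >= 2], and [3 m <= 6 K]. *)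
Lemma le_exp3_ln {R : realType} (d m : nat) (K : R) :
  (2 <= d)%N -> m%:R <= 2 * K ->
  ((2 * d).+1 ^ m)%N%:R <= expR (6 * K * ln (d%:R : R)).
Proof.
move=> d2 mK.
have d0 : (0 : R) < d%:R by rewrite ltr0n; lia.
have lnd : 0 <= ln (d%:R : R) by rewrite ln_ge0// ler1n; lia.
have step : ((2 * d).+1 <= d ^ 3)%N by rewrite !expnS expn0; nia.
apply: (@le_trans _ _ ((d ^ 3) ^ m)%N%:R).
  by rewrite ler_nat; case: (m) => // m'; rewrite leq_exp2r.
rewrite -expnM natrX -[X in X ^+ _]lnK ?posrE// -expRM_natl ler_expR.
rewrite ler_wpM2r// natrM; lra.
Qed.

Definition grid_steps {R : realType} {d : nat} (h : 'I_d -> R) : seq 'cV[R]_d :=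
  0 :: [seq h j *: delta_mx j 0 | j <- enum 'I_d] ++
       [seq - h j *: delta_mx j 0 | j <- enum 'I_d].

Lemma size_grid_steps {R : realType} (d : nat) (h : 'I_d -> R) :
  size (grid_steps h) = (2 * d).+1%N.
Proof.
rewrite /grid_steps /= size_cat !size_map.
by rewrite -enumT size_enum_ord addnn mul2n.
Qed.

(** In the orthant of [x] the step counts [|x_j| / h_j] are linear coordinates; rounding them in the
    integral polytope raises each modulus by at most one mesh. *)
Lemma grid_round {R : realType} (d m : nat) (h : 'I_d -> R) (F : 'cV[R]_d -> R)
    (x : 'cV[R]_d) :
  (forall j, 0 < h j) -> quasiconvex F -> \sum_j `|x j 0| / h j <= m%:R ->
  exists z, [/\ z \in fold_sums (grid_steps h) m,
    forall j, `|z j 0| <= `|x j 0| + h j & F x <= F z].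
Proof.
move=> h0 qcF xm.
pose e j : R := if 0 <= x j 0 then 1 else -1.
have e1 j : `|e j| = 1 by rewrite /e; case: ifP; rewrite ?normrN normr1.
have xE j : x j 0 = e j * `|x j 0|.
  rewrite /e; case: ifPn => [x0|]; first by rewrite mul1r ger0_norm.
  by rewrite -ltNge => x0; rewrite ltr0_norm// mulrNN mul1r.
pose w j : 'cV[R]_d := (e j * h j) *: delta_mx j 0.
have scE (f : 'I_d -> R) i : (\sum_j f j *: w j) i 0 = f i * (e i * h i).
  rewrite summxE (bigD1 i)//= big1 => [|j ji]; last first.
    by rewrite !mxE eq_sym (negPf ji) !mulr0.
  by rewrite !mxE !eqxx addr0 mulr1.
pose H (f : {ffun 'I_d -> R}) := F (\sum_j f j *: w j).
have qcH : quasiconvex H.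
  move=> t f g t01; have := qcF t (\sum_j f j *: w j) (\sum_j g j *: w j) t01.
  suff -> : H (t *: f + (1 - t) *: g) =
    F (t *: (\sum_j f j *: w j) + (1 - t) *: (\sum_j g j *: w j)) by [].
  congr F; rewrite !scaler_sumr -big_split/=; apply: eq_bigr => j _.
  by rewrite !scalerA -scalerDl !ffunE mulrDl.
pose y : {ffun 'I_d -> R} := [ffun j => `|x j 0| / h j].
have [||q [qm qy Hq]] := quasiconvex_round_nat _ _ y m qcH.
- by move=> j; rewrite ffunE divr_ge0// ltW.
- by under eq_bigr do rewrite ffunE.
exists (\sum_j w j *+ q j); split.
- apply: mem_fold_sums => //; first by rewrite inE eqxx.
  move=> j; rewrite /w /e inE mem_cat; apply/orP; right.
  case: ifP => _; rewrite ?mul1r ?mulN1r.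
    by apply/orP; left; apply/mapP; exists j; rewrite ?mem_enum.
  by apply/orP; right; apply/mapP; exists j; rewrite ?mem_enum.
- move=> j; under eq_bigr do rewrite -scaler_nat.
  rewrite scE normrM ger0_norm// normrM e1 mul1r gtr0_norm//.
  have := qy j; rewrite ffunE => /(ler_wpM2r (ltW (h0 j)))/le_trans; apply.
  by rewrite mulrDl mul1r divfK// gt_eqF.
- have -> : F x = H y.
    congr F; apply/colP => j; rewrite scE ffunE mulrCA divfK ?gt_eqF//.
  apply: (le_trans Hq); rewrite /H le_eqVlt; apply/orP; left; apply/eqP; congr F.
  by apply: eq_bigr => j _; rewrite ffunE scaler_nat.
Qed.

Lemma diagonal_net {R : realType} (d : nat) (s : 'I_d -> R) :
  (0 < d)%N -> (forall j, 0 < s j <= 1) -> 1 <= \sum_j s j ->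
  exists N : seq 'cV[R]_d,
  [/\ (size N)%:R <= expR (6 * (\sum_j s j) * ln (d%:R : R)),
      forall z : 'cV[R]_d, z \in N -> \sum_j (s j * z j 0) ^+ 2 <= 4 &
      forall F : 'cV[R]_d -> R, (forall x, F (- x) = F x) -> quasiconvex F ->
      forall x : 'cV[R]_d, \sum_j x j 0 ^+ 2 <= 1 -> exists2 z, z \in N & F x <= F z].
Proof.
move=> d0 s01 K1; set K := \sum_j s j in K1 *.
have [d1|d2] : d = 1%N \/ (2 <= d)%N by lia.
  (* Here [ln d = 0], so only one point is allowed; evenness of [F] lets it stand for both ends of
     the segment. *)
  subst d; exists [:: const_mx 1]; split.
  - by rewrite ln1 mulr0 expR0.
  - move=> z; rewrite inE => /eqP ->; rewrite big_ord1 mxE mulr1.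
    have /andP[? ?] := s01 ord0; nra.
  - move=> F FN qcF x; rewrite big_ord1 => x1; exists (const_mx 1); first by rewrite inE.
    have t01 : 0 <= (1 + x 0 0) / 2 <= 1 by apply/andP; split; nra.
    have := qcF _ (const_mx 1) (- const_mx 1) t01; rewrite FN maxxx.
    congr (F _ <= _); apply/colP => i; rewrite !ord1 !mxE; by field.
pose h j : R := (Num.sqrt (K * s j))^-1.
have s0 j : 0 < s j by have /andP[] := s01 j.
have K0 : 0 < K by lra.
have Ks0 j : 0 < K * s j by rewrite mulr_gt0.
have h0 j : 0 < h j by rewrite invr_gt0 sqrtr_gt0.
have h2 j : h j ^+ 2 = (K * s j)^-1 by rewrite exprVn sqr_sqrtr// ltW.
(* Since [K >= 1], [m <= K + 1 <= 2 K], as the count requires. *)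
pose m := (Num.truncn K).+1.
have /andP[mK Km] := truncn_itv (ltW K0).
(* Grid points outside the ellipsoid are discarded, which only lowers the count; it remains to see
   that rounding stays inside. *)
exists [seq z : 'cV[R]_d <- fold_sums (grid_steps h) m | \sum_j (s j * z j 0) ^+ 2 <= 4]; split.
- apply: (@le_trans _ _ ((2 * d).+1 ^ m)%N%:R); last first.
    by apply: le_exp3_ln => //; rewrite /m -natr1; lra.
  rewrite ler_nat size_filter (leq_trans (count_size _ _))// size_fold_sums.
  by rewrite size_grid_steps.
- by move=> z; rewrite mem_filter => /andP[].
- move=> F _ qcF x x1.
  have xm : \sum_j `|x j 0| / h j <= m%:R.
    apply: le_trans (ltW Km).
    (* AM-GM for [sqrt K |x_j|] and [sqrt s_j]; the right sides sum to at most [(K + K) / 2]. *)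
    have le j : `|x j 0| / h j <= (K * x j 0 ^+ 2 + s j) / 2.
      rewrite /h invrK (sqrtrM _ (ltW K0)) -[x j 0 ^+ 2]real_normK ?num_real//.
      have := sqr_ge0 (Num.sqrt K * `|x j 0| - Num.sqrt (s j)).
      rewrite sqrrB exprMn (sqr_sqrtr (ltW K0)) (sqr_sqrtr (ltW (s0 j))); lra.
    apply: (le_trans (ler_sum _ (fun j _ => le j))).
    rewrite -mulr_suml big_split/= -mulr_sumr -/K; nra.
  have [z [zN zx Fz]] := grid_round _ _ _ _ _ h0 qcF xm.
  exists z => //; rewrite mem_filter zN andbT.
  (* From [|z_j| <= |x_j| + h_j], [s_j <= 1] and [s_j^2 h_j^2 = s_j / K]; the sum is at most
     [2 (1 + 1) = 4]. *)
  have le j : (s j * z j 0) ^+ 2 <= 2 * (x j 0 ^+ 2 + s j / K).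
    have zz : z j 0 ^+ 2 <= 2 * (x j 0 ^+ 2 + h j ^+ 2).
      rewrite -[z j 0 ^+ 2]real_normK ?num_real// -[x j 0 ^+ 2]real_normK ?num_real//.
      apply: (@le_trans _ _ ((`|x j 0| + h j) ^+ 2)).
        by rewrite lerXn2r ?nnegrE ?zx// addr_ge0// ltW.
      have := sqr_ge0 (`|x j 0| - h j); rewrite sqrrB sqrrD; lra.
    rewrite exprMn; have /andP[sj0 sj1] := s01 j.
    apply: (le_trans (ler_wpM2l (sqr_ge0 _) zz)); rewrite h2 mulrCA ler_wpM2l// mulrDr.
    apply: lerD; first by rewrite ler_piMl ?sqr_ge0// expr_le1// ltW.
    by rewrite le_eqVlt; apply/orP; left; apply/eqP; field; rewrite !gt_eqF.
  apply: (le_trans (ler_sum _ (fun j _ => le j))).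
  rewrite -mulr_sumr big_split/= -mulr_suml -/K divff ?gt_eqF//; lra.
Qed.

(** * The net *)

Lemma qform_orthodiag {R : realType} (d : nat) (U : 'M[R]_d) (l : 'I_d -> R) (x : 'cV[R]_d) :
  qform (U^T *m diag_mx (\row_i l i) *m U) x = \sum_j l j * (U *m x) j 0 ^+ 2.
Proof.
have -> : U^T *m diag_mx (\row_i l i) *m U = U^T *m (diag_mx (\row_i l i) *m U).
  by rewrite mulmxA.
rewrite /qform !mulmxA -trmx_mul -mulmxA -mulmxA mulmxA mxE; apply: eq_bigr => j _.
by rewrite mul_mx_diag !mxE expr2 mulrCA mulrA.
Qed.

Lemma sumsqE {R : realType} (d : nat) (x : 'cV[R]_d) :
  \sum_j x j 0 ^+ 2 = (x^T *m x) 0 0.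
Proof. by rewrite mxE; apply: eq_bigr => j _; rewrite mxE expr2. Qed.

(** In an eigenbasis [Sigma / s1^2] is diagonal with entries [s_j^2], and the orthogonal change of
    basis preserves the ball, evenness and quasiconvexity, so [diagonal_net] applies there. *)
Lemma ellipsoid_net {R : realType} (d r : nat) (Sigma : 'M[R]_d) (sigma : 'I_d -> R) :
  (0 < d)%N -> (2 <= r)%N -> posdef Sigma -> (forall i, 0 <= sigma i) ->
  char_poly Sigma = \prod_(i < d) ('X - (sigma i ^+ 2)%:P) ->
  let s1 := sigma_max sigma in
  [/\ 0 < s1, 1 <= d_eff sigma r & exists N : seq 'cV[R]_d,
  [/\ (size N)%:R <= expR (6 * (d_eff sigma r * ln (d%:R : R))),
      forall z, z \in N -> qform Sigma z <= 4 * s1 ^+ 2 &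
      forall F : 'cV[R]_d -> R, (forall x, F (- x) = F x) -> quasiconvex F ->
      forall x, unit_ball x -> exists2 z, z \in N & F x <= F z]].
Proof.
move=> d0 r2 [symS posS] sigma0 charS s1.
have [U [UU SE]] := symmetric_orthodiag _ _ _ symS charS.
have UTU : U^T *m U = 1%:M by apply: mulmx1C.
(* Positivity is tested on the eigenvector [U^T e_j], where the form equals [sigma_j^2]; the mesh
   needs every ratio to be nonzero. *)
have sig0 j : 0 < sigma j.
  have xn0 : U^T *m delta_mx j 0 != 0 :> 'cV[R]_d.
    apply/eqP => /(congr1 (mulmx U)); rewrite mulmxA UU mul1mx mulmx0.
    by move=> /matrixP/(_ j 0)/eqP; rewrite !mxE !eqxx oner_eq0.
  have := posS _ xn0; rewrite SE qform_orthodiag mulmxA UU mul1mx.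
  rewrite (bigD1 j)//= big1 ?addr0 => [|i ij]; last by rewrite mxE (negPf ij) expr0n mulr0.
  rewrite mxE !eqxx expr1n mulr1 => sj2.
  rewrite lt_neqAle sigma0 andbT eq_sym; apply/eqP => sj0.
  by move: sj2; rewrite sj0 expr0n ltxx.
have sle j : sigma j <= s1 by apply: le_bigmax.
have s10 : 0 < s1 by apply: lt_le_trans (sig0 (Ordinal d0)) (sle _).
pose s j := sigma j / s1.
have s01 j : 0 < s j <= 1 by rewrite divr_gt0//= ler_pdivrMr// mul1r.
(* Here [0 < s_j <= 1] and [2 / r <= 1]: this is where [r >= 2] enters. *)
have s_powR j : s j <= powR (s j) (2 / r%:R).
  have /andP[sj0 sj1] := s01 j; rewrite -{1}[s j]powRr1 ?(ltW sj0)//.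
  apply: ger_powR; rewrite ?sj0// ler_pdivrMr ?mul1r ?ler_nat// ltr0n; lia.
(* The largest [sigma] contributes the ratio 1. *)
have K1 : 1 <= \sum_j s j.
  have [i _ si] : exists2 i, true & s1 = sigma i.
    rewrite /s1 /sigma_max; have [|i _ ->] := @eq_bigmax _ R _ 0 (Ordinal d0) xpredT sigma isT;
       [move=> j _; exact: sigma0 | by exists i].
  rewrite (bigD1 i)//= {1}/s si divff ?gt_eqF// lerDl sumr_ge0// => j _.
  by have /andP[/ltW] := s01 j.
have Kd : \sum_j s j <= d_eff sigma r by apply: ler_sum => j _; exact: s_powR.
split=> //; first exact: le_trans Kd.
have [N [sizeN QN FN]] := diagonal_net d s d0 s01 K1.
exists [seq U^T *m z | z <- N]; split.
- rewrite size_map (le_trans sizeN)// ler_expR -mulrA ler_wpM2l// ler_wpM2r//.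
  by rewrite ln_ge0// ler1n.
- move=> _ /mapP[z zN ->]; rewrite SE qform_orthodiag mulmxA UU mul1mx.
  have -> : \sum_j sigma j ^+ 2 * z j 0 ^+ 2 = s1 ^+ 2 * \sum_j (s j * z j 0) ^+ 2.
    rewrite mulr_sumr; apply: eq_bigr => j _; rewrite /s; field.
    by rewrite gt_eqF.
  by rewrite mulrC ler_wpM2r ?sqr_ge0// QN.
- move=> F Feven qcF x x1.
  have [|||z zN Fz] := FN (fun y => F (U^T *m y)) _ _ (U *m x).
  + by move=> y; rewrite mulmxN.
  + by move=> t y y' t01; rewrite mulmxDr -!scalemxAr; exact: qcF.
  + by rewrite sumsqE trmx_mul -mulmxA (mulmxA U^T) UTU mul1mx -sumsqE.
  exists (U^T *m z); first by apply/mapP; exists z.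
  by move: Fz; rewrite mulmxA UTU mul1mx.
Qed.

(** * The convex majorant [psi] of the truncated power *)

(** A power lies above its tangent at [c]; multiplying by [p] in the induction leaves the defect
    [(k+1) c^k (p - c)^2]. *)
Lemma bernoulli_tangent {R : realDomainType} (c p : R) (k : nat) :
  0 <= c -> 0 <= p -> c ^+ k.+1 + k.+1%:R * c ^+ k * (p - c) <= p ^+ k.+1.
Proof.
move=> c0 p0; elim: k => [|k IHk]; first by rewrite !expr1 expr0 !mul1r addrC subrK.
apply: (le_trans _ (ler_wpM2l p0 IHk)); rewrite -subr_ge0.
have -> : p * (c ^+ k.+1 + k.+1%:R * c ^+ k * (p - c)) -
   (c ^+ k.+2 + k.+2%:R * c ^+ k.+1 * (p - c)) = k.+1%:R * c ^+ k * (p - c) ^+ 2.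
  rewrite !exprS -[in k.+2%:R]natr1; ring.
by rewrite mulr_ge0 ?sqr_ge0// mulr_ge0// exprn_ge0.
Qed.

(* Extending the power by its tangent beyond [|v| = b], instead of truncating it,
   keeps it convex. *)
Definition psi {R : realType} (k : nat) (b v : R) : R :=
  let c := Num.min `|v| b in c ^+ k.+2 + k.+2%:R * c ^+ k.+1 * (`|v| - c).

Section psi.
Context {R : realType} (k : nat) (b : R) (b0 : 0 <= b).

Lemma psiN (v : R) : psi k b (- v) = psi k b v.
Proof. by rewrite /psi normrN. Qed.

(** Together with its definition, this exhibits [psi] as the largest of the tangents to the power of
    [|v|] at contact points in [[0, b]]. *)
Lemma tangent_le_psi (c v : R) : 0 <= c <= b ->
  c ^+ k.+2 + k.+2%:R * c ^+ k.+1 * (`|v| - c) <= psi k b v.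
Proof.
move=> /andP[c0 cb]; rewrite /psi; case: (leP `|v| b) => vb.
  by rewrite subrr mulr0 addr0; apply: bernoulli_tangent.
have := bernoulli_tangent c b k.+1 c0 b0.
have : c ^+ k.+1 <= b ^+ k.+1 by rewrite lerXn2r.
move: (c ^+ k.+1) (b ^+ k.+1) (c ^+ k.+2) (b ^+ k.+2) => c1 b1 c2 b2 cb1 tan.
(* First the tangent inequality at [b], then the slope is raised from that at [c] to that at [b]. *)
apply: (@le_trans _ _ (b2 + k.+2%:R * c1 * (`|v| - b))); first by lra.
rewrite lerD2l ler_wpM2r ?subr_ge0 ?(ltW vb)// ler_wpM2l//.
Qed.

(** The tangent attaining [psi] at the combination is affine and nondecreasing in [|v|], and lies
    below [psi] at both endpoints. *)
Lemma psi_convex (t u v : R) : 0 <= t <= 1 ->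
  psi k b (t * u + (1 - t) * v) <= t * psi k b u + (1 - t) * psi k b v.
Proof.
move=> /andP[t0 t1]; rewrite {1}/psi /=; set w := t * u + _; set c := Num.min _ _.
have c0 : 0 <= c by rewrite le_min normr_ge0.
have cb : 0 <= c <= b by rewrite c0 ge_min lexx orbT.
have t1' : 0 <= 1 - t by rewrite subr_ge0.
have w_le : `|w| <= t * `|u| + (1 - t) * `|v|.
  by rewrite (le_trans (ler_normD _ _))// !normrM (ger0_norm t0) (ger0_norm t1').
have := ler_wpM2l t0 (tangent_le_psi c u cb).
have := ler_wpM2l t1' (tangent_le_psi c v cb).
have ck : 0 <= k.+2%:R * c ^+ k.+1 by rewrite mulr_ge0// exprn_ge0.
have := ler_wpM2l ck w_le.
move: (k.+2%:R * c ^+ k.+1) (c ^+ k.+2) => c1 c2; lra.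
Qed.

Lemma psi_le_exp (v : R) : psi k b v <= `|v| ^+ k.+2.
Proof. by apply: bernoulli_tangent; rewrite // le_min normr_ge0. Qed.

Lemma psi_ge0 (v : R) : 0 <= psi k b v.
Proof.
have c0 : 0 <= Num.min `|v| b by rewrite le_min normr_ge0.
rewrite /psi addr_ge0 ?exprn_ge0//; apply: mulr_ge0; first by rewrite mulr_ge0// exprn_ge0.
by rewrite subr_ge0 ge_min lexx.
Qed.

Lemma min_le_psi (v : R) : Num.min (`|v| ^+ k.+2) (b ^+ k.+2) <= psi k b v.
Proof.
rewrite /psi; case: (leP `|v| b) => vb.
  by rewrite subrr mulr0 addr0 ge_min lexx.
rewrite ge_min; apply/orP; right.
rewrite lerDl; apply: mulr_ge0; first by rewrite mulr_ge0// exprn_ge0.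
by rewrite subr_ge0 ltW.
Qed.

(** Beyond [b] the growth is only linear, so a parabola with coefficient of order [b^k] suffices.
    The factor [b^k] becomes [(B / sigma_1^r)^(1 - 2/r)] in the theorem. *)
Lemma psi_le_sqr (v : R) : psi k b v <= k.+2%:R * b ^+ k * v ^+ 2.
Proof.
have bk : 0 <= b ^+ k by rewrite exprn_ge0.
have k2 : (1 : R) <= k.+2%:R by rewrite ler1n.
rewrite -[v ^+ 2]real_normK ?num_real// /psi; have := normr_ge0 v; move: `|v| => w w0.
case: (leP w b) => wb.
  rewrite subrr mulr0 addr0 -[k.+2 in X in X <= _]addn2 exprD.
  rewrite ler_wpM2r ?sqr_ge0// (@le_trans _ _ (b ^+ k))//; first by rewrite lerXn2r.
  by rewrite ler_peMl.
rewrite !exprS.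
have wb0 : 0 <= w - b by rewrite subr_ge0 ltW.
have k20 : 0 <= (k.+2%:R : R) - 1 by rewrite subr_ge0.
have := mulr_ge0 (ler0n R k.+2) (mulr_ge0 bk (mulr_ge0 w0 wb0)).
have := mulr_ge0 k20 (mulr_ge0 bk (mulr_ge0 b0 b0)).
move: (k.+2%:R : R) (b ^+ k) => K X; nra.
Qed.

Lemma quasiconvex_sum_psi (I : finType) (V : lmodType R) (g : I -> V -> R) :
  (forall i, {morph g i : x y / x + y}) -> (forall i t x, g i (t *: x) = t * g i x) ->
  quasiconvex (fun x => \sum_i psi k b (g i x)).
Proof.
move=> gD gZ t x y /andP[t0 t1].
apply: (@le_trans _ _ (t * (\sum_i psi k b (g i x)) + (1 - t) * (\sum_i psi k b (g i y)))).
  rewrite !mulr_sumr -big_split/=; apply: ler_sum => i _.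
  by rewrite gD !gZ; apply: psi_convex; rewrite t0.
set X := \sum_i _; set Y := \sum_i _.
have Xm : X <= Num.max X Y by rewrite le_max lexx.
have Ym : Y <= Num.max X Y by rewrite le_max lexx orbT.
move: (Num.max X Y) Xm Ym => M Xm Ym; nra.
Qed.

End psi.

(** * Products of independent factors *)

Section independence.
Context {R : realType} {d0 : measure_display} {T : measurableType d0} (P : probability T R).

Lemma cvg_integral_nd (u : nat -> T -> R) (v : T -> R) :
  (forall m, measurable_fun setT (u m)) -> (forall m w, 0 <= u m w) ->
  (forall w, {homo u ^~ w : m m' / (m <= m')%N >-> m <= m'}) ->
  (forall w, (u m w)%:E @[m --> \oo] --> (v w)%:E) ->
  (\int[P]_w (u m w)%:E)%E @[m --> \oo] --> (\int[P]_w (v w)%:E)%E.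
Proof.
move=> mu u0 ndu uv.
have := @cvg_monotone_convergence _ _ _ P _ measurableT (fun m w => (u m w)%:E).
have -> : (\int[P]_w limn (fun m => (u m w)%:E))%E = (\int[P]_w (v w)%:E)%E.
  by apply: eq_integral => w _; apply/cvg_lim.
apply.
- by move=> m; apply/measurable_EFinP.
- by move=> m w _; rewrite lee_fin.
- by move=> w _ m m' mm'; rewrite lee_fin ndu.
Qed.

(** With [c] as the mean of [G], the product rule extends from events of [X] to [X] itself by simple
    functions and monotone convergence. *)
Lemma integral_mul_factor (G X : T -> R) (c : R) :
  measurable_fun setT G -> (forall w, 0 <= G w) ->
  measurable_fun setT X -> (forall w, 0 <= X w) ->
  (forall B, measurable B ->
    (\int[P]_w (G w * \1_(X @^-1` B) w)%:E = c%:E * P (X @^-1` B))%E) ->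
  (\int[P]_w (G w * X w)%:E = c%:E * \int[P]_w (X w)%:E)%E.
Proof.
move=> mG G0 mX X0 GX.
(* The approximation is done on the real line and composed with [X], so that the level sets are
   preimages under [X], as the hypothesis demands; [|x|] keeps it nonnegative everywhere. *)
pose f (x : R) : \bar R := `|x|%:E.
have mf : measurable_fun [set: R] f by apply/measurable_EFinP; exact: normr_measurable.
pose a := nnsfun_approx measurableT mf.
have mpre m y : measurable (a m @^-1` [set y]) by [].
have mXpre m y : measurable (X @^-1` (a m @^-1` [set y])).
  by rewrite -[X @^-1` _]setTI; exact: mX.
pose rs m : seq R := finmap.enum_fset (fset_set (range (a m))).
have aE m x : a m x = \sum_(y <- rs m) `|y| * \1_(a m @^-1` [set y]) x.
  rewrite fimfunE fsbig_finite//=; apply: eq_big_seq => y; rewrite in_fset_set// inE.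
  by move=> -[x' _ <-]; rewrite ger0_norm.
have m1 m y : measurable_fun setT (\1_(X @^-1` (a m @^-1` [set y])) : T -> R).
  exact: measurable_indic.
have mG1 m y : measurable_fun setT (fun w => G w * \1_(X @^-1` (a m @^-1` [set y])) w).
  exact: measurable_funM.
have step m : (\int[P]_w (G w * a m (X w))%:E = c%:E * \int[P]_w (a m (X w))%:E)%E.
  transitivity (\sum_(y <- rs m) `|y|%:E * (c%:E * P (X @^-1` (a m @^-1` [set y]))))%E.
    under eq_integral => w _.
      rewrite aE mulr_sumr -sumEFin.
      under eq_bigr => y _ do rewrite mulrCA EFinM.
      over.
    rewrite ge0_integral_sum//; last first.
    - by move=> y w _; rewrite -EFinM lee_fin mulr_ge0// mulr_ge0.
    - by move=> y; apply: emeasurable_funM => //; apply/measurable_EFinP; exact: mG1.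
    apply: eq_bigr => y _; rewrite ge0_integralZl_EFin//.
    - by rewrite -GX.
    - by move=> w _; rewrite lee_fin mulr_ge0.
    - by apply/measurable_EFinP; exact: mG1.
  have -> : (\int[P]_w (a m (X w))%:E =
      \int[P]_w \sum_(y <- rs m) (`|y|%:E * (\1_(X @^-1` (a m @^-1` [set y])) w)%:E))%E.
    apply: eq_integral => w _; rewrite aE -sumEFin.
    by apply: eq_bigr => y _; rewrite EFinM.
  rewrite ge0_integral_sum//; last first.
    by move=> y; apply: emeasurable_funM => //; apply/measurable_EFinP; exact: m1.
  rewrite ge0_sume_distrr; last first.
    by move=> y _; apply: integral_ge0 => w _; rewrite -EFinM lee_fin mulr_ge0.
  apply: eq_bigr => y _; rewrite ge0_integralZl_EFin//; last by apply/measurable_EFinP; exact: m1.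
  by rewrite muleCA -[X in P X]setIT -integral_indic.
have nda w : {homo (fun m => a m (X w)) : m m' / (m <= m')%N >-> m <= m'}.
  by move=> m m' mm'; have /lefP := nd_nnsfun_approx measurableT mf mm'; apply.
have aX w : (a m (X w))%:E @[m --> \oo] --> (X w)%:E.
  have f0 x : setT x -> (0 <= f x)%E by rewrite lee_fin.
  have := cvg_nnsfun_approx measurableT mf f0 (I : setT (X w)).
  by rewrite {2}/f ger0_norm.
have ma m : measurable_fun setT (fun w => a m (X w)) by apply: measurableT_comp.
have := cvg_integral_nd (fun m w => a m (X w)) X ma (fun m w => fun_ge0 _) nda aX.
have /[swap] : (\int[P]_w (G w * a m (X w))%:E)%E @[m --> \oo] --> (\int[P]_w (G w * X w)%:E)%E.
  apply: cvg_integral_nd.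
  - by move=> m; exact: measurable_funM.
  - by move=> m w; rewrite mulr_ge0.
  - by move=> w m m' mm'; rewrite ler_wpM2l// nda.
  - move=> w; under eq_fun do rewrite EFinM.
    by rewrite EFinM; apply: cvgeZl.
move=> aXcvg; 
have cX : (c%:E * \int[P]_w (a m (X w))%:E)%E @[m --> \oo] -->
    (c%:E * \int[P]_w (X w)%:E)%E by apply: cvgeZl.
under eq_fun do rewrite step.
by move=> Y; exact: (cvg_unique _ Y cX).
Qed.

(* The factors X i are turned one at a time from indicators of events of a i into
   arbitrary nonnegative functions of a i; S is the set of the indices already done. *)
Lemma integral_prod_mutually_independent_aux (n d : nat) (a : 'I_n -> T -> 'cV[R]_d)
    (S : {set 'I_n}) (X : 'I_n -> T -> R) (mu : 'I_n -> R) :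
  mutually_independent P a -> (forall i, random_vector (a i)) ->
  (forall i w, 0 <= X i w) ->
  (forall i, i \in S -> forall B, measurable B -> vec_sigma (a i) (X i @^-1` B)) ->
  (forall i, i \notin S -> exists2 E, vec_sigma (a i) E & X i = \1_E) ->
  (forall i, \int[P]_w (X i w)%:E = (mu i)%:E)%E ->
  (\int[P]_w (\prod_i X i w)%:E = (\prod_i mu i)%:E)%E.
Proof.
move=> indep rv; have mvec i E : vec_sigma (a i) E -> measurable E.
  by move=> [A mA <-]; exact: rv.
have [m] := ubnP #|S|; elim: m S X mu => // m IHm S X mu Sm X0 XS XnS Xmu.
have mX i : measurable_fun setT (X i).
  have [iS|/XnS[E aE ->]] := boolP (i \in S); last exact/measurable_indic/mvec/aE.
  by move=> _ B mB; rewrite setTI; exact/mvec/XS.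
(* When [S] is empty the product is the indicator of an intersection, and independence of events
   applies. *)
have [S0|[i iS]] := set_0Vmem S.
  have /choice[E aE] : forall i, exists E, vec_sigma (a i) E /\ X i = \1_E.
    by move=> i; have [|E ? ?] := XnS i; [rewrite S0 inE | exists E].
  have mE i : measurable (E i) by exact: mvec (aE i).1.
  have muE i : P (E i) = (mu i)%:E.
    by rewrite -Xmu (aE i).2 integral_indic// setIT.
  set C := \bigcap_(i in [set i | i \in [set: 'I_n]%SET]) E i.
  have PC : P C = (\prod_i mu i)%:E.
    rewrite indep => [|i _]; last exact: (aE i).1.
    by rewrite -prodEFin; apply: eq_big => [i|i _]; rewrite ?inE ?muE.
  have mC : measurable C by apply: fin_bigcap_measurable.
  rewrite -PC -[in RHS](setIT C) -integral_indic//; apply: eq_integral => w _.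
  congr EFin; rewrite indicE; have [wC|wC] := boolP (w \in C).
    apply: big1 => i _; rewrite (aE i).2 indicE mem_set//.
    by move: wC; rewrite inE => /(_ i); apply; rewrite /= inE.
  have [i wi] : exists i, ~ E i w.
    apply: contrapT => /forallNP wE; move/negP: wC; apply; rewrite inE => i _.
    by apply: contrapT; exact: wE.
  by rewrite (bigD1 i)//= (aE i).2 indicE memNset ?mul0r.
have [Pi] : exists Pi : set R -> R, forall B, measurable B -> P (X i @^-1` B) = (Pi B)%:E.
  exists (fun B => fine (P (X i @^-1` B))) => B mB.
  by rewrite fineK// fin_num_measure//; exact/mvec/XS.
move=> PiE.
have := @integral_mul_factor (fun w => \prod_(j | j != i) X j w) (X i) (\prod_(j | j != i) mu j).
have -> : (\int[P]_w (\prod_j X j w)%:E =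
    \int[P]_w ((\prod_(j | j != i) X j w) * X i w)%:E)%E.
  by apply: eq_integral => w _; rewrite (bigD1 i)//= mulrC.
move=> ->//.
- by rewrite Xmu -EFinM [in RHS](bigD1 i)//= mulrC.
- under eq_fun do rewrite big_mkcond /=.
  by apply: measurable_prod => j _; case: (j != i).
- by move=> w; apply: prodr_ge0.
- move=> B mB.
  (* Factor [i] is replaced by the indicator of [X i] lying in [B], which removes [i] from [S]; the
     induction hypothesis then gives what [integral_mul_factor] requires. *)
  pose X' j : T -> R := if j == i then \1_(X i @^-1` B) else X j.
  pose mu' j := if j == i then Pi B else mu j.
  have X'j j : j != i -> X' j = X j by rewrite /X' => /negPf ->.
  have -> : (\int[P]_w ((\prod_(j | j != i) X j w) * \1_(X i @^-1` B) w)%:E =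
      \int[P]_w (\prod_j X' j w)%:E)%E.
    apply: eq_integral => w _; rewrite [in RHS](bigD1 i)//= {1}/X' eqxx mulrC.
    by congr (_ * _)%:E; apply: eq_bigr => j ji; rewrite X'j.
  rewrite (IHm (S :\ i)%SET X' mu').
  + rewrite (bigD1 i)//= {1}/mu' eqxx PiE// -EFinM mulrC.
    by congr (_ * _)%:E; apply: eq_bigr => j /negPf ji; rewrite /mu' ji.
  + by move: Sm; rewrite (cardsD1 i) iS.
  + by move=> j w; rewrite /X'; case: ifP.
  + by move=> j; rewrite !inE => /andP[ji jS]; rewrite X'j//; exact: XS.
  + move=> j; rewrite !inE negb_and negbK => /orP[/eqP ->|jS].
      by exists (X i @^-1` B); [exact: XS|rewrite /X' eqxx].
    have ji : j != i by apply: contraNneq jS => ->.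
    by rewrite X'j//; exact: XnS.
  + move=> j; rewrite /X' /mu'; case: eqP => // _.
    have mXB : measurable (X i @^-1` B) := mvec _ _ (XS i iS B mB).
    by rewrite integral_indic// setIT; exact: PiE.
Qed.

Lemma integral_prod_mutually_independent (n d : nat) (a : 'I_n -> T -> 'cV[R]_d)
    (g : 'cV[R]_d -> R) (mu : 'I_n -> R) :
  mutually_independent P a -> (forall i, random_vector (a i)) ->
  (forall x, 0 <= g x) -> (forall B, measurable B -> cV_measurable (g @^-1` B)) ->
  (forall i, \int[P]_w (g (a i w))%:E = (mu i)%:E)%E ->
  (\int[P]_w (\prod_i g (a i w))%:E = (\prod_i mu i)%:E)%E.
Proof.
move=> indep rv g0 mg gmu.
apply: (integral_prod_mutually_independent_aux _ _ a [set: 'I_n]%SET (fun i => g \o a i)) => //.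
- by move=> i w /=.
- by move=> i _ B mB; exists (g @^-1` B) => //; exact: mg.
- by move=> i; rewrite inE.
Qed.

End independence.

(** * Exponential moments *)

Section tails.
Context {R : realType} {d0 : measure_display} {T : measurableType d0} (P : probability T R).

(** Slicing by integer parts: [W <= 1] costs at most [e], and the slice [m + 1 <= W < m + 2] costs
    at most [e^(m+2)] times the probability of [m < W]. *)
Lemma expR_tail_integral (W : T -> R) :
  measurable_fun setT W ->
  (forall m : nat, (P [set w | (m%:R < W w)%R] <= (2 * expR (- (2 * m%:R)))%:E)%E) ->
  (\int[P]_w (expR (W w))%:E <= (expR 1 + 4 * expR 2)%:E)%E.
Proof.
move=> mW tailW; pose A m := [set w | (m%:R < W w)%R].
have mA m : measurable (A m).
  rewrite -[A m]setTI (_ : A m = W @^-1` `]m%:R, +oo[); last first.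
    by apply/seteqP; split => w; rewrite /= in_itv/= andbT.
  by apply: mW.
have m1 m : measurable_fun setT (\1_(A m) : T -> R) by exact: measurable_indic.
pose F m w : \bar R := ((expR m.+2%:R)%:E * (\1_(A m) w)%:E)%E.
have F0 m w : (0 <= F m w)%E by rewrite /F -EFinM lee_fin mulr_ge0// expR_ge0.
have mF m : measurable_fun setT (F m).
  by apply: emeasurable_funM => //; apply/measurable_EFinP; exact: m1.
have mexp : measurable_fun setT (fun w => expR (W w)) by apply: measurableT_comp.
have le_series w : ((expR (W w))%:E <= (expR 1)%:E + \sum_(m <oo) F m w)%E.
  have [W1|W1] := leP (W w) 1.
    rewrite -[leLHS]adde0 leeD// ?lee_fin ?ler_expR//.
    by apply: nneseries_ge0 => m _ _.
  have W0 : 0 <= W w by rewrite ltW// (lt_trans _ W1).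
  have /andP[] := truncn_itv W0; move tE : (Num.truncn (W w)) => [|m] W2 W3.
    by move: (lt_trans W1 W3); rewrite ltxx.
  (* The integer part is [m + 1], which gives the strict inequality [m < W] of the tail events. *)
  apply: (@le_trans _ _ (F m w)).
    rewrite /F indicE mem_set ?mule1 ?lee_fin ?ler_expR ?ltW//.
    by rewrite /A/= (lt_le_trans _ W2)// ltr_nat.
  rewrite -[leLHS]add0e leeD ?lee_fin ?expR_ge0//.
  apply: (le_trans _ (nneseries_lim_ge m.+1 _)); last by move=> *; exact: F0.
  by rewrite big_nat_recr//= leeDr// sume_ge0.
apply: (@le_trans _ _ (\int[P]_w ((expR 1)%:E + \sum_(m <oo) F m w))%E).
  apply: ge0_le_integral => //.
  - exact/measurable_EFinP.
  - by apply: emeasurable_funD => //; apply: ge0_emeasurable_sum.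
rewrite ge0_integralD//; last 2 first.
- by move=> w _; apply: nneseries_ge0.
- by apply: ge0_emeasurable_sum.
rewrite EFinD leeD//.
  by rewrite integral_cst// [X in (_ * X)%E](probability_setT P) mule1.
rewrite integral_nneseries//.
(* Each term is [2 e^(2 - m)], compared with a geometric series of ratio 1/2 through [e >= 2]. *)
apply: (@le_trans _ _ (\sum_(m <oo) (4 * expR 2 / (2 ^ m.+1)%:R)%:E)%E); last first.
  by apply: epsilon_trick0; rewrite mulr_ge0// expR_ge0.
apply: lee_nneseries => [m _ _|m _]; first by apply: integral_ge0.
rewrite ge0_integralZl_EFin ?expR_ge0//; last by apply/measurable_EFinP; exact: m1.
rewrite integral_indic// setIT.
apply: (le_trans (lee_wpmul2l _ (tailW m))); first by rewrite lee_fin expR_ge0.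
rewrite -EFinM lee_fin mulrCA -expRD.
have -> : m.+2%:R + - (2 * m%:R) = 2 + - m%:R :> R by rewrite -[m.+2]addn2 natrD; lra.
rewrite expRD expRN -[m%:R]mulr1 expRM_natl natrX exprS invfM.
have -> : 4 * expR 2 * (2^-1 / 2 ^+ m) = 2 * (expR 2 / 2 ^+ m) :> R by field.
rewrite ler_wpM2l// ler_wpM2l ?expR_ge0// lef_pV2 ?posrE ?exprn_gt0 ?expR_gt0//.
by rewrite lerXn2r ?nnegrE ?expR_ge0// (le_trans _ (expR_ge1Dx 1)).
Qed.

(** The factor in [expR_psi_le] times the bound of [expR_tail_integral]. *)
Definition mgf_const (k : nat) : R :=
  (1 + (k.+2)`!%:R * 32 ^+ k.+2) * (expR 1 + 4 * expR 2).

(** Chosen so that [psi_le_sqr] gives [mgf_rate k b * psi k b v <= v^2 / 32]. *)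
Definition mgf_rate (k : nat) (b : R) : R := (32 * (k.+2%:R * b ^+ k))^-1.

Lemma mgf_const_gt0 (k : nat) : 0 < mgf_const k.
Proof.
by rewrite /mgf_const mulr_gt0.
Qed.

Lemma mgf_rate_gt0 (k : nat) (b : R) : 0 < b -> 0 < mgf_rate k b.
Proof. by move=> b0; rewrite invr_gt0 !mulr_gt0// exprn_gt0. Qed.

(** In [e^x <= 1 + x e^x] the factor [x] is bounded through [psi <= |v|^(k+2)] and the exponential
    through the parabola. Keeping the rate in front makes the resulting mean bound independent of
    [b]. *)
Lemma expR_psi_le (k : nat) (b v : R) : 0 < b ->
  expR (mgf_rate k b * psi k b v) <=
  1 + mgf_rate k b * (1 + (k.+2)`!%:R * 32 ^+ k.+2) * expR (v ^+ 2 / 16).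
Proof.
move=> b0; have r0 := mgf_rate_gt0 k b b0.
set x := _ * psi k b v; have x0 : 0 <= x by rewrite mulr_ge0 ?psi_ge0 ?ltW.
have xv : x <= v ^+ 2 / 32.
  apply: (le_trans (ler_wpM2l (ltW r0) (psi_le_sqr k b (ltW b0) v))).
  rewrite le_eqVlt; apply/orP; left; apply/eqP; rewrite /mgf_rate.
  have bk : b ^+ k != 0 by rewrite expf_neq0// gt_eqF.
  have k2 : k.+2%:R != 0 :> R by rewrite pnatr_eq0.
  move: (k.+2%:R : R) (b ^+ k) k2 bk => K B K0 B0.
  by field; rewrite B0 K0.
(* This is [1 - x <= e^(-x)] multiplied by [e^x]. *)
have exp_le : expR x <= 1 + x * expR x.
  have := expR_ge1Dx (- x); rewrite expRN => H.
  have := ler_wpM2r (expR_ge0 x) H; rewrite mulVf ?gt_eqF ?expR_gt0// mulrDl mul1r mulNr; lra.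
apply: (le_trans exp_le); rewrite lerD2l -[x * _]mulrA -[leRHS]mulrA.
apply: ler_wpM2l; first exact: ltW.
have -> : v ^+ 2 / 16 = v ^+ 2 / 32 + v ^+ 2 / 32 by field.
rewrite expRD mulrA; apply: ler_pM.
- exact/psi_ge0/ltW.
- exact: expR_ge0.
- apply: (le_trans (psi_le_exp k b (ltW b0) v)).
  have y0 : 0 <= v ^+ 2 / 32 by rewrite divr_ge0 ?sqr_ge0.
  have e1 : 1 <= expR (v ^+ 2 / 32) by apply: le_trans (expR_ge1Dx _); rewrite lerDl.
  have := expR_ge1Dxn k.+1 y0; set E := expR _ in e1 * => He.
  have f0 : 0 < (k.+2)`!%:R :> R by rewrite ltr0n fact_gt0.
  (* One term of the exponential series, [y^(k+2) / (k+2)! <= e^y]. *)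
  have {He} : (v ^+ 2 / 32) ^+ k.+2 <= (k.+2)`!%:R * E.
    rewrite [leRHS]mulrC -ler_pdivrMr//; apply: le_trans He; by rewrite lerDr.
  rewrite expr_div_n ler_pdivrMr ?exprn_gt0// => He.
  rewrite mulrDl mul1r.
  have -> : (k.+2)`!%:R * 32 ^+ k.+2 * E = (k.+2)`!%:R * E * 32 ^+ k.+2 by rewrite mulrAC.
  have [v1|v1] := leP `|v| 1.
    apply: (@le_trans _ _ E); first by rewrite (le_trans _ e1)// exprn_ile1.
    rewrite lerDl; apply: mulr_ge0; last exact: exprn_ge0.
    by apply: mulr_ge0; [exact: ltW|exact: expR_ge0].
  apply: (@le_trans _ _ ((v ^+ 2) ^+ k.+2)); last by rewrite (le_trans He)// lerDr expR_ge0.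
  rewrite -[v ^+ 2]real_normK ?num_real// -exprM ler_weXn2l ?(ltW v1)//.
  by rewrite mul2n -addnn leq_addl.
- by rewrite ler_expR.
Qed.

Lemma psi_measurable (k : nat) (b : R) : measurable_fun setT (psi k b : R -> R).
Proof.
have mc : measurable_fun setT (fun v : R => Num.min `|v| b).
  by apply: measurable_minr => //; exact: normr_measurable.
apply: measurable_funD; first exact: measurable_funX.
apply: measurable_funM; first by apply: measurable_funM => //; exact: measurable_funX.
by apply: measurable_funB => //; exact: normr_measurable.
Qed.

Lemma psi_mgf (k : nat) (b : R) (V : T -> R) : 0 < b -> measurable_fun setT V ->
  (forall t, 0 < t -> (P [set w | (t < `|V w|)%R] <= (2 * expR (- (t ^+ 2 / 8)))%:E)%E) ->
  (\int[P]_w (expR (mgf_rate k b * psi k b (V w)))%:E <=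
    (expR (mgf_rate k b * mgf_const k))%:E)%E.
Proof.
move=> b0 mV tailV; have r0 := mgf_rate_gt0 k b b0.
have mW : measurable_fun setT (fun w => V w ^+ 2 / 16).
  by apply: measurable_funM => //; exact: measurable_funX.
have mexp : measurable_fun setT (fun w => expR (V w ^+ 2 / 16)) by apply: measurableT_comp.
(* Take [t = 4 sqrt m], so that [t^2 / 8 = 2 m]; for [m = 0] the bound 2 is trivial. *)
have tailW m : (P [set w | (m%:R < V w ^+ 2 / 16)%R] <= (2 * expR (- (2 * m%:R)))%:E)%E.
  case: m => [|m].
    rewrite mulr0 oppr0 expR0 mulr1 (le_trans (probability_le1 _ _))// ?lee_fin ?ler1n//.
    rewrite -[X in measurable X]setTI (_ : mkset _ = (fun w => V w ^+ 2 / 16) @^-1` `]0, +oo[); last first.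
      by apply/seteqP; split => w; rewrite /= in_itv/= andbT.
    exact: mW.
  have t0 : 0 < 4 * Num.sqrt (m.+1%:R : R) by rewrite mulr_gt0// sqrtr_gt0.
  have := tailV _ t0; rewrite exprMn sqr_sqrtr//.
  have -> : 4 ^+ 2 * m.+1%:R / 8 = 2 * m.+1%:R :> R by field.
  have -> // : [set w | (4 * Num.sqrt m.+1%:R < `|V w|)%R] = [set w | (m.+1%:R < V w ^+ 2 / 16)%R].
  have h w : (4 * Num.sqrt m.+1%:R < `|V w|)%R = (m.+1%:R < V w ^+ 2 / 16)%R.
    rewrite ltr_pdivlMr// -[V w ^+ 2]real_normK ?num_real//.
    rewrite -(@ltr_pXn2r _ 2) ?nnegrE ?(ltW t0)// exprMn sqr_sqrtr//.
    by congr (_ < _); field.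
  by apply/seteqP; split => w /=; rewrite h.
have r1 : 0 <= mgf_rate k b * (1 + (k.+2)`!%:R * 32 ^+ k.+2).
  by rewrite mulr_ge0 ?ltW// ltr_wpDr// mulr_ge0// exprn_ge0.
apply: (@le_trans _ _ (\int[P]_w (1%:E +
    (mgf_rate k b * (1 + (k.+2)`!%:R * 32 ^+ k.+2))%:E * (expR (V w ^+ 2 / 16))%:E))%E).
  apply: ge0_le_integral => //.
  - apply/measurable_EFinP; apply: measurableT_comp => //.
    by apply: measurable_funM => //; apply: measurableT_comp => //; exact: psi_measurable.
  - apply: emeasurable_funD => //; apply: emeasurable_funM => //; exact/measurable_EFinP.
  - by move=> w _; rewrite -EFinM -EFinD lee_fin; exact: expR_psi_le.
have mE : measurable_fun setT (fun w => (expR (V w ^+ 2 / 16))%:E) by exact/measurable_EFinP.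
rewrite ge0_integralD//; last 2 first.
- by move=> w _; rewrite -EFinM lee_fin mulr_ge0// expR_ge0.
- by apply: emeasurable_funM.
rewrite integral_cst// [X in (_ * X)%E](probability_setT P) mule1.
rewrite ge0_integralZl_EFin//.
apply: (le_trans (leeD2l _ (lee_wpmul2l _ (expR_tail_integral _ mW tailW)))) => //.
rewrite -EFinM -EFinD lee_fin (le_trans _ (expR_ge1Dx _))// lerD2l /mgf_const.
by rewrite mulrA.
Qed.
End tails.

(** * Linear functionals and the Chernoff bound *)

Lemma dotvDr {R : realType} (d : nat) (a x y : 'cV[R]_d) :
  dotv a (x + y) = dotv a x + dotv a y.
Proof. by rewrite /dotv -big_split/=; apply: eq_bigr => j _; rewrite mxE mulrDr. Qed.

Lemma dotvZr {R : realType} (d : nat) (a x : 'cV[R]_d) (c : R) :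
  dotv a (c *: x) = c * dotv a x.
Proof. by rewrite /dotv mulr_sumr; apply: eq_bigr => j _; rewrite mxE mulrCA. Qed.

Lemma qformZ {R : realType} (d : nat) (S : 'M[R]_d) (x : 'cV[R]_d) (c : R) :
  qform S (c *: x) = c ^+ 2 * qform S x.
Proof. by rewrite /qform [(c *: x)^T]linearZ /= -!scalemxAl -scalemxAr scalerA mxE expr2. Qed.

(* [g_sigma_algebraType] needs a pointed carrier. *)
Definition pointed_cV (R : realType) (d : nat) := 'cV[R]_d.
HB.instance Definition _ (R : realType) (d : nat) := Choice.on (pointed_cV R d).
HB.instance Definition _ (R : realType) (d : nat) :=
  isPointed.Build (pointed_cV R d) (0 : 'cV[R]_d).

Lemma dotv_measurable {R : realType} (d : nat) (z : 'cV[R]_d) (g : R -> R) (B : set R) :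
  measurable_fun setT g -> measurable B -> cV_measurable ((fun x => g (dotv x z)) @^-1` B).
Proof.
move=> mg mB.
pose G : set (set (pointed_cV R d)) := [set C | exists (j : 'I_d) (A : set R),
  measurable A /\ C = [set x : 'cV[R]_d | A (x j 0)]].
have mcoord (j : 'I_d) : measurable_fun setT (fun x : g_sigma_algebraType G => (x : 'cV[R]_d) j 0).
  by move=> _ A mA; rewrite setTI; apply: sub_sigma_algebra; exists j, A.
have mdot : measurable_fun setT (fun x : g_sigma_algebraType G => dotv (x : 'cV[R]_d) z).
  by apply: measurable_sum => j; apply: measurable_funM.
have /(_ measurableT _ mB) := measurableT_comp mg mdot.
by rewrite setTI.
Qed.

Section chernoff.
Context {R : realType} {d0 : measure_display} {T : measurableType d0} (P : probability T R).

Lemma random_vector_dotv (d : nat) (a : T -> 'cV[R]_d) (z : 'cV[R]_d) :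
  random_vector a -> measurable_fun setT (fun w => dotv (a w) z).
Proof.
move=> rva _ B mB; rewrite setTI.
exact: rva (dotv_measurable _ z id B (@measurable_id _ _ _) mB).
Qed.

(** The subgaussian bound is homogeneous in [x], so normalizing [z] extends it beyond the ball; the
    exponent is then at least [t^2 s^2 / (8 s^2)]. *)
Lemma subgaussian_dotv (d : nat) (S : 'M[R]_d) (a : T -> 'cV[R]_d) (z : 'cV[R]_d) (s t : R) :
  posdef S -> subgaussian P S a -> 0 < s -> qform S z <= 4 * s ^+ 2 -> 0 < t ->
  (P [set w | (t < `|dotv (a w) z / s|)%R] <= (2 * expR (- (t ^+ 2 / 8)))%:E)%E.
Proof.
move=> [_ posS] sub s0 qz t0; have [->|z0] := eqVneq z 0.
  rewrite (_ : mkset _ = set0) ?measure0 ?lee_fin ?mulr_ge0 ?expR_ge0//.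
  apply/seteqP; split => w //=; rewrite -(scale0r (0 : 'cV[R]_d)) dotvZr !mul0r normr0.
  by rewrite ltNge ltW.
have q0 := posS z z0.
pose nu := Num.sqrt (\sum_j z j 0 ^+ 2).
have nu2 : 0 < \sum_j z j 0 ^+ 2.
  rewrite lt_neqAle sumr_ge0 ?andbT => [|j _]; last exact: sqr_ge0.
  apply: contra_neq z0 => /esym/eqP; rewrite psumr_eq0 => [/allP z0|j _]; last exact: sqr_ge0.
  apply/colP => j; rewrite mxE; have := z0 j (mem_index_enum j).
  by rewrite /= sqrf_eq0 => /eqP.
have nu0 : 0 < nu by rewrite sqrtr_gt0.
have zu : unit_ball (nu^-1 *: z).
  rewrite /unit_ball /=; under eq_bigr do rewrite mxE exprMn.
  by rewrite -mulr_sumr exprVn (sqr_sqrtr (ltW nu2)) mulVf// gt_eqF.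
have tnu : 0 < t * s / nu by rewrite divr_gt0 ?mulr_gt0.
have := sub _ _ tnu zu.
have -> : [set w | (t * s / nu < `|dotv (a w) (nu^-1 *: z)|)%R] =
    [set w | (t < `|dotv (a w) z / s|)%R].
  have h w : (t * s / nu < `|dotv (a w) (nu^-1 *: z)|)%R = (t < `|dotv (a w) z / s|)%R.
    rewrite dotvZr !normrM !normfV (gtr0_norm s0) (gtr0_norm nu0) [in RHS]ltr_pdivlMr// mulrC.
    by rewrite ltr_pM2l ?invr_gt0.
  by apply/seteqP; split => w /=; rewrite h.
move=> /le_trans; apply; rewrite lee_fin ler_wpM2l// ler_expR lerN2 qformZ.
have -> : (t * s / nu) ^+ 2 / (2 * (nu^-1 ^+ 2 * qform S z)) = t ^+ 2 * s ^+ 2 / (2 * qform S z).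
  by field; rewrite !gt_eqF.
rewrite ler_pdivlMr ?mulr_gt0//.
have t2 := sqr_ge0 t; nra.
Qed.

(** Exponential Markov inequality at rate [th]: independence bounds the moment by [e^(n th M)], and
    the threshold times [th] is [n th M + lambda]. *)
Lemma psi_chernoff (n d k : nat) (a : 'I_n -> T -> 'cV[R]_d) (z : 'cV[R]_d) (b s lambda : R) :
  mutually_independent P a -> (forall i, random_vector (a i)) -> 0 < b ->
  (forall i t, 0 < t ->
    (P [set w | (t < `|dotv (a i w) z / s|)%R] <= (2 * expR (- (t ^+ 2 / 8)))%:E)%E) ->
  let E := [set w | n%:R * mgf_const k + lambda / mgf_rate k b <=
    \sum_i psi k b (dotv (a i w) z / s)] in
  measurable E /\ (P E <= (expR (- lambda))%:E)%E.
Proof.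
move=> indep rv b0 tail E.
set th := mgf_rate k b; set M := mgf_const k in E *.
have th0 : 0 < th := mgf_rate_gt0 k b b0.
pose g x := expR (th * psi k b (dotv x z / s)).
have mpsi : measurable_fun setT (fun v : R => psi k b (v / s)).
  by apply: measurableT_comp; [exact: psi_measurable|exact: measurable_funM].
have mg B : measurable B -> cV_measurable (g @^-1` B).
  move=> mB; apply: (dotv_measurable d z (fun v => expR (th * psi k b (v / s)))) => //; apply: measurableT_comp => //.
  exact: measurable_funM.
have mpsia i : measurable_fun setT (fun w => psi k b (dotv (a i w) z / s)).
  by apply: measurableT_comp mpsi _; exact: random_vector_dotv.
have msum : measurable_fun setT (fun w => \sum_i psi k b (dotv (a i w) z / s)).
  by apply: measurable_sum.
have mE : measurable E.
  rewrite -[E]setTI (_ : E = (fun w => \sum_i psi k b (dotv (a i w) z / s)) @^-1`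
     `[n%:R * M + lambda / th, +oo[); last first.
    by apply/seteqP; split => w; rewrite /= in_itv/= andbT.
  exact: msum.
split=> //.
have gle i : (\int[P]_w (g (a i w))%:E <= (expR (th * M))%:E)%E.
  apply: psi_mgf => //; last exact: tail.
  by apply: measurable_funM => //; exact: random_vector_dotv.
have g0 x : 0 <= g x by exact: expR_ge0.
have [mu muE] : exists mu : 'I_n -> R, forall i, (\int[P]_w (g (a i w))%:E = (mu i)%:E)%E.
  exists (fun i => fine (\int[P]_w (g (a i w))%:E)%E) => i.
  rewrite fineK// ge0_fin_numE; first exact: le_lt_trans (gle i) (ltry _).
  by apply: integral_ge0 => w _; rewrite lee_fin.
have prodE := integral_prod_mutually_independent P n d a g mu indep rv g0 mg muE.
have mu0 i : 0 <= mu i by rewrite -lee_fin -muE; apply: integral_ge0 => w _; rewrite lee_fin.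
have prodle : \prod_i mu i <= expR (th * M) ^+ n.
  rewrite -[in leRHS](card_ord n) -prodr_const; apply: ler_prod => i _.
  by rewrite mu0/= -lee_fin -muE; exact: gle.
have expE w : \prod_i g (a i w) = expR (th * \sum_i psi k b (dotv (a i w) z / s)).
  by rewrite mulr_sumr expR_sum.
pose c := expR (th * (n%:R * M + lambda / th)).
(* Markov: on [E] the product of the [g (a i w)] is at least [c]. *)
have : (c%:E * P E <= (\prod_i mu i)%:E)%E.
  rewrite -prodE -[X in P X]setIT -integral_indic// -ge0_integralZl_EFin//; last 2 first.
  - by apply/measurable_EFinP; exact: measurable_indic.
  - exact: expR_ge0.
  apply: ge0_le_integral => //.
  - by move=> w _; rewrite -EFinM lee_fin mulr_ge0// expR_ge0.
  - by apply: emeasurable_funM => //; apply/measurable_EFinP; exact: measurable_indic.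
  - apply/measurable_EFinP; under eq_fun do rewrite expE.
    by apply: measurableT_comp => //; exact: measurable_funM.
  - move=> w _; rewrite -EFinM lee_fin expE indicE.
    have [|] := boolP (w \in E); last by rewrite mulr0 expR_ge0.
    by rewrite inE mulr1 => Ew; rewrite ler_expR ler_wpM2l// ltW.
have PEfin : P E \is a fin_num by exact: fin_num_measure.
rewrite -(fineK PEfin) -EFinM !lee_fin => cP.
have := le_trans cP prodle.
have cE : th * (n%:R * M + lambda / th) = n%:R * (th * M) + lambda.
  by field; rewrite gt_eqF.
rewrite /c cE expRD expRM_natl -mulrA -[leRHS]mulr1 ler_pM2l ?exprn_gt0 ?expR_gt0//.
by rewrite expRN -ler_pdivlMl ?expR_gt0// mulr1.
Qed.
End chernoff.

(** * Measurability of the supremum *)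

Lemma cvg_sumr {R : realType} (I : Type) (s : seq I) (u : I -> nat -> R) (l : I -> R) :
  (forall i, u i m @[m --> \oo] --> l i) ->
  (\sum_(i <- s) u i m) @[m --> \oo] --> \sum_(i <- s) l i.
Proof.
move=> ul; elim: s => [|i s IHs].
  by under eq_fun do rewrite big_nil; rewrite big_nil; exact: cvg_cst.
by under eq_fun do rewrite big_cons; rewrite big_cons; exact: cvgD.
Qed.

Lemma cvg_prodr {R : realType} (I : Type) (s : seq I) (u : I -> nat -> R) (l : I -> R) :
  (forall i, u i m @[m --> \oo] --> l i) ->
  (\prod_(i <- s) u i m) @[m --> \oo] --> \prod_(i <- s) l i.
Proof.
move=> ul; elim: s => [|i s IHs].
  by under eq_fun do rewrite big_nil; rewrite big_nil; exact: cvg_cst.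
by under eq_fun do rewrite big_cons; rewrite big_cons; exact: cvgM.
Qed.

Lemma cvg_lipschitz1 {R : realType} {U : Type} {F : set_system U} {FF : Filter F}
    (f : R -> R) (u : U -> R) (l : R) :
  lipschitz1 f -> u m @[m --> F] --> l -> f (u m) @[m --> F] --> f l.
Proof.
move=> lipf /cvgrPdist_lt ul; apply/cvgrPdist_lt => e e0.
by near=> m; rewrite (le_lt_trans (lipf _ _))//; near: m; exact: ul.
Unshelve. all: by end_near. Qed.

(** Rounding is towards zero, so that rounded points stay in the unit ball. *)
Definition grid_trunc {R : realType} (m : nat) (x : R) : int :=
  if 0 <= x then Num.floor (m.+1%:R * x) else - Num.floor (m.+1%:R * - x).

Lemma grid_trunc_bounds {R : realType} (m : nat) (x : R) :
  let v := (grid_trunc m x)%:~R / m.+1%:R in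
  `|v| <= `|x| /\ `|x - v| <= m.+1%:R^-1.
Proof.
wlog x0 : x / 0 <= x => [H|].
  have [x0|x0] := leP 0 x; first exact: H.
  have xN : 0 <= - x by rewrite oppr_ge0 ltW.
  have [] := H _ xN; rewrite /grid_trunc xN (lt_geF x0) rmorphN/= mulNr !normrN.
  by move=> h1 h2; split=> //; rewrite -normrN opprD opprK.
move=> v; rewrite /v /grid_trunc x0.
have m0 : 0 < m.+1%:R :> R by [].
have /andP[f1 f2] := floor_itv (m.+1%:R * x).
have f0 : 0 <= (Num.floor (m.+1%:R * x))%:~R :> R.
  by rewrite ler0z floor_ge0 mulr_ge0.
split.
  by rewrite !ger0_norm// ?divr_ge0// ler_pdivrMr// [leRHS]mulrC.
rewrite ger0_norm; last by rewrite subr_ge0 ler_pdivrMr// [leRHS]mulrC.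
rewrite lerBlDr -[X in _ <= X + _]mul1r -mulrDl ler_pdivlMr// [leLHS]mulrC addrC.
by rewrite ltW//; move: f2; rewrite intrD.
Qed.

Lemma grid_trunc_cvg {R : realType} (x : R) :
  (grid_trunc m x)%:~R / m.+1%:R @[m --> \oo] --> x.
Proof.
apply/cvgrPdist_le => e e0.
have /cvgrPdist_le /(_ _ e0) := @cvg_harmonic R.
apply: filterS => m; rewrite sub0r normrN => me.
have [_ h] := grid_trunc_bounds m x.
by apply: (le_trans h); apply: le_trans me; exact: ler_norm.
Qed.

Lemma unit_ball_coord_le1 {R : realType} (d : nat) (x : 'cV[R]_d) (j : 'I_d) : unit_ball x -> `|x j 0| <= 1.
Proof.
move=> x1; rewrite -(@ler_pXn2r _ 2)// ?nnegrE// expr1n real_normK ?num_real//.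
apply: le_trans x1; rewrite (bigD1 j)//= lerDl sumr_ge0// => i _; exact: sqr_ge0.
Qed.

Lemma unit_ball0 {R : realType} (d : nat) : unit_ball (0 : 'cV[R]_d).
Proof. by rewrite /unit_ball /= big1// => j _; rewrite mxE expr0n. Qed.

Lemma lipschitz1_norm {R : realType} (f : R -> R) (u : R) : lipschitz1 f -> f 0 = 0 -> `|f u| <= `|u|.
Proof. by move=> lipf f0; have := lipf u 0; rewrite f0 !subr0. Qed.

(** Rules out the default value of [sup]: coordinates of points of the ball are at most 1, so each
    factor is bounded by the l1 norm of [a i w]. *)
Lemma has_sup_Ysup {R : realType} {T : Type} (n d r : nat) (a : 'I_n -> T -> 'cV[R]_d)
    (f : 'I_r -> R -> R) (w : T) :
  (forall k, lipschitz1 (f k)) -> (forall k, f k 0 = 0) ->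
  has_sup [set y | exists xs : 'I_r -> 'cV[R]_d, (forall k, unit_ball (xs k)) /\
        y = n%:R^-1 * \sum_(i < n) \prod_(k < r) f k (dotv (a i w) (xs k))].
Proof.
move=> lipf f0; split.
  by exists (n%:R^-1 * \sum_(i < n) \prod_(k < r) f k (dotv (a i w) 0)), (fun=> 0);
    split=> // k; exact: unit_ball0.
exists (n%:R^-1 * \sum_(i < n) \prod_(k < r) \sum_j `|a i w j 0|) => _ [xs [xs1 ->]].
rewrite ler_wpM2l// ler_sum// => i _; rewrite (le_trans (ler_norm _))// normr_prod.
apply: ler_prod => k _; rewrite normr_ge0 (le_trans (lipschitz1_norm _ _ (lipf k) (f0 k)))//.
rewrite (le_trans (ler_norm_sum _ _ _))// ler_sum// => j _.
by rewrite normrM ler_piMr// unit_ball_coord_le1.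
Qed.

(** By continuity the supremum exceeds a level iff some tuple of rational points of the ball does,
    which is a countable union of events. *)
Lemma measurable_Ysup_ge {R : realType} {d0 : measure_display} {T : measurableType d0}
    (n d r : nat) (a : 'I_n -> T -> 'cV[R]_d) (f : 'I_r -> R -> R) (t : R) :
  (forall i, random_vector (a i)) -> (forall k, lipschitz1 (f k)) -> (forall k, f k 0 = 0) ->
  measurable [set w | t <= Ysup a f w].
Proof.
move=> rv lipf f0.
pose G (xs : 'I_r -> 'cV[R]_d) w :=
  n%:R^-1 * \sum_(i < n) \prod_(k < r) f k (dotv (a i w) (xs k)).
have mf k : measurable_fun setT (f k).
  by apply: continuous_measurable_fun => x; exact: cvg_lipschitz1 (lipf k) cvg_id.
have mG xs : measurable_fun setT (G xs).
  apply: measurable_funM => //; apply: measurable_sum => i; apply: measurable_prod => k _.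
  by apply: measurableT_comp => //; exact: random_vector_dotv.
(* All coordinates share the denominator [p.1 + 1], which makes the index set countable. *)
pose pt (p : nat * {ffun 'I_r * 'I_d -> int}) k : 'cV[R]_d :=
  \col_j ((p.2 (k, j))%:~R / p.1.+1%:R).
have gtE s : [set w | s < Ysup a f w] =
    \bigcup_p (if `[<forall k, unit_ball (pt p k)>] then [set w | s < G (pt p) w] else set0).
  apply/seteqP; split => w /=.
    move=> /sup_gt[|_ [xs [xs1 ->]] sG]; first by have [] := has_sup_Ysup n d r a f w lipf f0.
    pose p m := (m, [ffun kj => grid_trunc m (xs kj.1 kj.2 0)]) : nat * {ffun 'I_r * 'I_d -> int}.
    have pE m k j : pt (p m) k j 0 = (grid_trunc m (xs k j 0))%:~R / m.+1%:R.
      by rewrite mxE ffunE.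
    have p1 m k : unit_ball (pt (p m) k).
      apply: le_trans (xs1 k); apply: ler_sum => j _.
      rewrite pE -[leLHS]real_normK ?num_real// -[leRHS]real_normK ?num_real//.
      by rewrite lerXn2r ?nnegrE//; have [] := grid_trunc_bounds m (xs k j 0).
    have Gcvg : G (pt (p m)) w @[m --> \oo] --> G xs w.
      apply: cvgM; first exact: cvg_cst.
      apply: cvg_sumr => i; apply: cvg_prodr => k; apply: cvg_lipschitz1 => //.
      apply: cvg_sumr => j; apply: cvgM; first exact: cvg_cst.
      by under eq_fun do rewrite pE; exact: grid_trunc_cvg.
    have [m sm] := filter_ex (cvgr_gt _ Gcvg _ sG).
    by exists (p m) => //; rewrite asboolT.
  move=> [p _]; case: asboolP => // p1 sG; apply: (lt_le_trans sG).
  apply: ub_le_sup; first by have [] := has_sup_Ysup n d r a f w lipf f0.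
  by exists (pt p).
have mY : measurable_fun setT (Ysup a f).
  apply: (measurability _ (RGenOInfty.measurableE R)) => //.
  move=> _ [_ [s ->] <-]; rewrite setTI.
  rewrite (_ : _ @^-1` _ = [set w | s < Ysup a f w]); last first.
    by apply/seteqP; split => w; rewrite /= in_itv/= andbT.
  rewrite gtE; apply: countable_bigcupT_measurable => // p.
  case: asboolP => // _; rewrite -[X in measurable X]setTI.
  rewrite (_ : mkset _ = G (pt p) @^-1` `]s, +oo[); last first.
    by apply/seteqP; split => w; rewrite /= in_itv/= andbT.
  exact: mG.
rewrite -[X in measurable X]setTI (_ : mkset _ = Ysup a f @^-1` `[t, +oo[); last first.
  by apply/seteqP; split => w; rewrite /= in_itv/= andbT.
exact: mY.
Qed.

(** * Conclusion *)

Lemma union_bound {R : realType} {d0 : measure_display} {T : measurableType d0}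
    (P : probability T R) (I : eqType) (N : seq I) (A : I -> set T) (c : R) :
  (forall z, z \in N -> measurable (A z) /\ (P (A z) <= c%:E)%E) ->
  let U := [set w | exists2 z, z \in N & A z w] in
  measurable U /\ (P U <= ((size N)%:R * c)%:E)%E.
Proof.
elim: N => [|z N IHN] AN U.
  have -> : U = set0 by apply/seteqP; split => w //= -[].
  by rewrite measure0 mul0r.
have [mz Pz] := AN z (mem_head _ _).
have [|mN PN] := IHN; first by move=> y yN; apply: AN; rewrite inE yN orbT.
set V := [set w | exists2 y, y \in N & A y w] in mN PN.
have -> : U = A z `|` V.
  apply/seteqP; split => w /=.
    by move=> [y]; rewrite inE => /orP[/eqP ->|yN]; [left|right; exists y].
  by move=> [Az|[y yN Ay]]; [exists z; rewrite ?mem_head|exists y; rewrite ?inE ?yN ?orbT].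
split; first exact: measurableU.
apply: (le_trans (measureU2 _ mz mN)).
by rewrite -[(size _)%:R]natr1 mulrDl mul1r addrC EFinD leeD.
Qed.

Lemma prod_le_sum_psi {R : realType} (k : nat) (b p : R) (u : 'I_k.+2 -> R) :
  0 <= b -> p <= \prod_l `|u l| -> p <= b ^+ k.+2 -> p <= \sum_l psi k b (u l).
Proof.
move=> b0 pu pb.
have [l _ ul] : exists2 l, true & forall l', `|u l'| <= `|u l|.
  by case: (@arg_maxP _ _ _ ord0 xpredT (fun l => `|u l|)) => // l _ H; exists l => // l'; exact: H.
apply: (@le_trans _ _ (psi k b (u l))); last first.
  by rewrite (bigD1 l)//= lerDl sumr_ge0// => l' _; exact: psi_ge0.
apply: le_trans (min_le_psi _ _ b0 _); rewrite le_min pb andbT (le_trans pu)//.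
rewrite -[X in _ ^+ X](card_ord k.+2) -prodr_const.
by apply: ler_prod => l' _; rewrite normr_ge0 ul.
Qed.

(** A pathwise bound: each product is at most the product of the [|a_i.x_l|], by the Lipschitz
    condition, and at most that of the [Bk l]. The factor [k + 2] counts the summands of
    [prod_le_sum_psi]. *)
Lemma Ysup_le_psi {R : realType} {T : Type} (n d k : nat) (a : 'I_n -> T -> 'cV[R]_d)
    (f : 'I_k.+2 -> R -> R) (Bk : 'I_k.+2 -> R) (w : T) (s b m : R) :
  0 < s -> 0 <= b -> \prod_l Bk l = s ^+ k.+2 * b ^+ k.+2 ->
  (forall l, lipschitz1 (f l)) -> (forall l, f l 0 = 0) ->
  (forall (x : 'cV[R]_d) i l, unit_ball x -> `|f l (dotv (a i w) x)| <= Bk l) ->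
  (forall x, unit_ball x -> \sum_i psi k b (dotv (a i w) x / s) <= m) ->
  Ysup a f w <= s ^+ k.+2 * k.+2%:R * (n%:R^-1 * m).
Proof.
move=> s0 b0 BE lipf f0 fB psim.
apply: sup_le_ub; first by have [] := has_sup_Ysup n d _ a f w lipf f0.
move=> _ [xs [xs1 ->]]; rewrite mulrCA ler_wpM2l//.
have sk : 0 < s ^+ k.+2 by rewrite exprn_gt0.
have sE : s ^+ k.+2 = \prod_(l < k.+2) s by rewrite prodr_const card_ord.
apply: (@le_trans _ _ (\sum_(i < n) s ^+ k.+2 * \sum_l psi k b (dotv (a i w) (xs l) / s))).
  apply: ler_sum => i _; rewrite mulrC -ler_pdivrMr//.
  apply: prod_le_sum_psi => //; rewrite ler_pdivrMr//.
    apply: (le_trans (ler_norm _)); rewrite normr_prod.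
    rewrite sE -big_split/=.
    apply: ler_prod => l _; rewrite normr_ge0 normrM normfV (gtr0_norm s0) divfK ?gt_eqF//.
    exact: lipschitz1_norm.
  apply: (le_trans (ler_norm _)); rewrite normr_prod mulrC -BE.
  by apply: ler_prod => l _; rewrite normr_ge0 fB.
rewrite -mulr_sumr -[leRHS]mulrA ler_wpM2l ?(ltW sk)// exchange_big/=.
apply: (@le_trans _ _ (\sum_(l < k.+2) m)); first by apply: ler_sum => l _; exact: psim.
by rewrite sumr_const card_ord mulr_natl.
Qed.

Theorem theorem2 (R : realType) (r : nat) (hr : (2 <= r)%N) :
  exists C : R, 0 < C /\
  forall (d n : nat), (1 <= d)%N -> (1 <= n)%N ->
  forall (d0 : measure_display) (T : measurableType d0) (P : probability T R)
    (Sigma : 'M[R]_d) (sigma : 'I_d -> R),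
    posdef Sigma ->
    (forall i, 0 <= sigma i) ->
    char_poly Sigma = \prod_(i < d) ('X - (sigma i ^+ 2)%:P) ->
  forall (a : 'I_n -> T -> 'cV[R]_d),
    iid P a -> (forall i, subgaussian P Sigma (a i)) ->
  forall (f : 'I_r -> R -> R), (forall k, lipschitz1 (f k)) -> (forall k, f k 0 = 0) ->
  forall (Bk : 'I_r -> R), (forall k, 0 < Bk k) ->
    {ae P, forall w, forall (x : 'cV[R]_d) (i : 'I_n) (k : 'I_r),
        unit_ball x -> `|f k (dotv (a i w) x)| <= Bk k} ->
  let B := \prod_(k < r) Bk k in
  let s1 := sigma_max sigma in
  forall lambda : R, 0 < lambda ->
    (P [set w | (s1 ^+ r * C *
                 (1 + (d_eff sigma r * ln d%:R + lambda) / n%:R *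
                      powR (B / s1 ^+ r) (1 - 2 / r%:R)) <= Ysup a f w)%R]
      <= ((expR (- lambda))%R)%:E)%E.
Proof.
move: r hr => [|[|k]]// r2.
pose M : R := mgf_const k; have M0 : 0 < M := mgf_const_gt0 k.
have K0 : (0 : R) < k.+2%:R by [].
(* [M] bounds the mean part, [192 = 6 * 32] combines the net exponent with [mgf_rate], and the outer
   factor is [r]. *)
exists (k.+2%:R * (M + 192 * k.+2%:R)); split; first by rewrite mulr_gt0// addr_gt0// mulr_gt0.
move=> d n d1 n1 d0 T P Sigma sigma posS sigma0 charS a [rv [indep _]] sub f lipf f0.
move=> Bk Bk0 aeB B s1 lambda lambda0.
have [s10 D1 [N [sizeN QN FN]]] := ellipsoid_net d k.+2 Sigma sigma d1 r2 posS sigma0 charS.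
rewrite -/s1 in s10 QN.
set D := d_eff sigma k.+2 in D1 sizeN *.
have L0 : 0 <= D * ln (d%:R : R) by rewrite mulr_ge0 ?ln_ge0 ?ler1n// (le_trans _ D1).
set L := D * ln d%:R in L0 sizeN *.
have B0 : 0 < B by apply: prodr_gt0.
have sk0 : 0 < s1 ^+ k.+2 by rewrite exprn_gt0.
(* The truncation level with [b^r = B / s1^r], so that [b^(r-2)] is the factor in the statement. *)
pose b := powR (B / s1 ^+ k.+2) (k.+2%:R^-1).
have b0 : 0 < b by rewrite powR_gt0// divr_gt0.
have Bs0 : 0 <= B / s1 ^+ k.+2 by rewrite divr_ge0 ?ltW.
have bB : B = s1 ^+ k.+2 * b ^+ k.+2.
  rewrite -[b ^+ k.+2]powR_mulrn ?(ltW b0)// -powRrM mulVf ?pnatr_eq0// powRr1//.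
  by rewrite mulrC divfK// gt_eqF.
have -> : powR (B / s1 ^+ k.+2) (1 - 2 / k.+2%:R) = b ^+ k.
  rewrite -[b ^+ k]powR_mulrn ?(ltW b0)// -powRrM; congr powR.
  by rewrite -[in LHS]addn2 -[in RHS]addn2 natrD; field; rewrite -natrD pnatr_eq0 addn2.
have bk0 : 0 < b ^+ k by rewrite exprn_gt0.
pose F x w := \sum_i psi k b (dotv (a i w) x / s1).
(* The extra [6 L] in the deviation pays for the union bound over the net. *)
pose tau := n%:R * M + (lambda + 6 * L) / mgf_rate k b.
pose Bad z := [set w | tau <= F z w].
have BadN z : z \in N -> measurable (Bad z) /\ (P (Bad z) <= (expR (- (lambda + 6 * L)))%:E)%E.
  move=> zN; apply: psi_chernoff => // i t t0.
  exact: subgaussian_dotv posS (sub i) s10 (QN z zN) t0.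
have [mU PU] := union_bound P _ N Bad _ BadN.
set U := [set w | exists2 z, z \in N & Bad z w] in mU PU.
have [Z [mZ PZ subZ]] := aeB.
set E := [set w | _].
have mE : measurable E by apply: measurable_Ysup_ge.
have EUZ : E `<=` U `|` Z.
  move=> w Ew; apply: contrapT => /not_orP[nU nZ].
  have fB (x : 'cV[R]_d) i l : unit_ball x -> `|f l (dotv (a i w) x)| <= Bk l.
    by move: x i l; apply: contrapT => nB; apply: nZ; apply: subZ.
  have n0 : (0 : R) < n%:R by rewrite ltr0n.
  (* A finite maximum stays strictly below [tau], as the non-strict event [E] requires; its default
     0 is harmless because [tau > 0]. *)
  pose m := \big[Num.max/0]_(z <- N) F z w.
  have tau0 : 0 < tau.
    rewrite ltr_wpDr ?mulr_gt0//.
    by rewrite divr_ge0 ?(ltW (mgf_rate_gt0 k b b0))// addr_ge0 ?(ltW lambda0)// mulr_ge0.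
  have mtau : m < tau.
    rewrite /m big_seq; apply: (big_ind (fun y => y < tau)) => // [y y' yt y't|z zN].
      by rewrite gt_max yt.
    by rewrite ltNge; apply/negP => Fz; apply: nU; exists z.
  have psim x : unit_ball x -> F x w <= m.
    move=> x1; have [||z zN Fz] := FN (fun x => F x w) _ _ x x1.
    - move=> y; apply: eq_bigr => i _.
      by rewrite -scaleN1r dotvZr mulN1r mulNr psiN.
    - have := @quasiconvex_sum_psi R k b (ltW b0) 'I_n 'cV[R]_d
        (fun i x => dotv (a i w) x / s1); apply.
        by move=> i y y'; rewrite dotvDr mulrDl.
      by move=> i t y; rewrite dotvZr mulrA.
    - by rewrite (le_trans Fz)//; exact: (le_bigmax_seq 0 z xpredT (fun z => F z w)).
  have := Ysup_le_psi n d k a f Bk w s1 b m s10 (ltW b0) bB lipf f0 fB psim.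
  apply/negP; rewrite -ltNge; apply: lt_le_trans Ew.
  apply: (@lt_le_trans _ _ (s1 ^+ k.+2 * k.+2%:R * (n%:R^-1 * tau))).
    by rewrite (ltr_pM2l (mulr_gt0 sk0 K0)) ltr_pM2l ?invr_gt0.
  rewrite -[leLHS]mulrA -[leRHS]mulrA ler_pM2l// -mulrA ler_pM2l//.
  have -> : n%:R^-1 * tau = M + 32 * k.+2%:R * (b ^+ k * ((lambda + 6 * L) / n%:R)).
    rewrite /tau /mgf_rate invrK; move: (k.+2%:R : R) (b ^+ k) => K X; field.
    by rewrite gt_eqF.
  have y0 : 0 <= b ^+ k * (L / n%:R) by rewrite mulr_ge0 ?(ltW bk0)// divr_ge0 ?(ltW lambda0).
  have z0 : 0 <= b ^+ k * (lambda / n%:R) by rewrite mulr_ge0 ?(ltW bk0)// divr_ge0 ?(ltW lambda0).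
  have -> : b ^+ k * ((lambda + 6 * L) / n%:R) =
      b ^+ k * (lambda / n%:R) + 6 * (b ^+ k * (L / n%:R)) by ring.
  have -> : (L + lambda) / n%:R * b ^+ k = b ^+ k * (L / n%:R) + b ^+ k * (lambda / n%:R) by ring.
  move: (b ^+ k * (L / n%:R)) (b ^+ k * (lambda / n%:R)) y0 z0 => y z y0 z0.
  move: (k.+2%:R : R) K0 => K K0.
  have := mulr_ge0 (ltW M0) (addr_ge0 y0 z0); have := mulr_ge0 (ltW K0) z0; lra.
apply: (@le_trans _ _ (P (U `|` Z))).
  by apply: le_measure => //; rewrite inE//; exact: measurableU.
apply: (le_trans (measureU2 _ mU mZ)); rewrite [X in (_ + X <= _)%E]PZ adde0 (le_trans PU)// lee_fin.
(* The size of the net is at most [e^(6 L)], which cancels [e^(- 6 L)]. *)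
rewrite opprD expRD mulrCA ler_piMr ?expR_ge0// expRN ler_pdivrMr ?expR_gt0// mul1r.
exact: sizeN.
Qed.
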